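(* There is an algorithm solving the feasibility problem of 0-1 integer programs with linear equality constraints, and an algorithm solving the optimization problem of 0-1 integer programs with linear equality constraints, each running in $O(m\cdot 2^{n/2}\,\mathrm{poly}(n))$ time, where $n$ is the number of variables and $m$ is the number of equality constraints.
   Context: Let $A$ be a real $m\times n$ matrix, $b\in\mathbb{R}^m$, $c\in\mathbb{R}^n$ (all entries are arbitrary real numbers). Feasibility problem: given $A,b$, find $x\in\{0,1\}^n$ with $Ax=b$, or report that none exists. Optimization problem: given $A,b,c$, minimize $c^Tx$ subject to $Ax=b$, $x\in\{0,1\}^n$; i.e. return the minimum value together with a minimizer, or report infeasibility. Here $\mathrm{poly}(n)$ denotes some polynomial in $n$. Since entries are arbitrary reals, the model is a real-number RAM: arithmetic operations on and comparisons of two real numbers take unit time. Standing assumption: $m\in O(\mathrm{poly}(n))$. *)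

(* Defs.v *)
From mathcomp Require Import all_boot all_order all_algebra.
From mathcomp Require Import reals exp.

Set Implicit Arguments.
Unset Strict Implicit.
Unset Printing Implicit Defensive.

Import Order.TTheory GRing.Theory Num.Theory.

Local Open Scope ring_scope.

(* The real-number RAM. Registers are named by the program text, so a program
   uses finitely many of them; the two memories are unbounded and are addressed
   through integer registers. Every instruction takes unit time.
   The only real constants are natural numbers, so that a program cannot hide
   information in a real literal and does not depend on the model of the reals.
   There is no conversion from real to integer (no floor), and the integers
   (natural numbers) have no unit-cost multiplication: these are the usual
   restrictions that keep unit-cost machines honest. *)
Inductive instr : Type :=
| IConst of nat & nat                (* dst, k *)
| IAdd of nat & nat & nat            (* dst, src1, src2 *)
| ISub of nat & nat & nat            (* truncated subtraction *)
| ILoad of nat & nat                 (* dst, register holding the address *)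
| IStore of nat & nat                (* register holding the address, src *)
| RConst of nat & nat
| RAdd of nat & nat & nat
| RSub of nat & nat & nat
| RMul of nat & nat & nat
| RDiv of nat & nat & nat            (* x / 0 = 0 *)
| RLoad of nat & nat
| RStore of nat & nat
| Jump of nat                        (* target *)
| JumpILe of nat & nat & nat         (* src1, src2, target *)
| JumpRLe of nat & nat & nat.

Definition program := seq instr.

Record config (R : realType) := Config {
  pc : nat;
  ireg : nat -> nat;
  rreg : nat -> R;
  imem : nat -> nat;
  rmem : nat -> R
}.

Definition exec (R : realType) (i : instr) (s : config R) : config R :=
  let: Config l ir rr im rm := s in
  match i with
  | IConst d k => Config l.+1 [eta ir with d |-> k] rr im rm
  | IAdd d x y => Config l.+1 [eta ir with d |-> (ir x + ir y)%N] rr im rm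
  | ISub d x y => Config l.+1 [eta ir with d |-> (ir x - ir y)%N] rr im rm
  | ILoad d a => Config l.+1 [eta ir with d |-> im (ir a)] rr im rm
  | IStore a x => Config l.+1 ir rr [eta im with ir a |-> ir x] rm
  | RConst d k => Config l.+1 ir [eta rr with d |-> k%:R] im rm
  | RAdd d x y => Config l.+1 ir [eta rr with d |-> rr x + rr y] im rm
  | RSub d x y => Config l.+1 ir [eta rr with d |-> rr x - rr y] im rm
  | RMul d x y => Config l.+1 ir [eta rr with d |-> rr x * rr y] im rm
  | RDiv d x y => Config l.+1 ir [eta rr with d |-> rr x / rr y] im rm
  | RLoad d a => Config l.+1 ir [eta rr with d |-> rm (ir a)] im rm
  | RStore a x => Config l.+1 ir rr im [eta rm with ir a |-> rr x]
  | Jump k => Config k ir rr im rm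
  | JumpILe x y k => Config (if (ir x <= ir y)%N then k else l.+1) ir rr im rm
  | JumpRLe x y k => Config (if rr x <= rr y then k else l.+1) ir rr im rm
  end.

(* [run P s t s']: started in [s], the program halts in [s'] after exactly [t]
   instructions; it halts when the program counter leaves the program. *)
Inductive run (R : realType) (P : program) :
    config R -> nat -> config R -> Prop :=
| run_halt s : onth P (pc s) = None -> run P s 0%N s
| run_step i s t s' :
    onth P (pc s) = Some i -> run P (exec i s) t s' -> run P s t.+1 s'.

(* Input: [m] and [n] in integer registers 0 and 1, the real data in the first
   cells of the real memory; everything else is zero. *)
Definition init (R : realType) (m n : nat) (data : seq R) : config R :=
  Config 0%N (nth 0%N [:: m; n]) (fun=> 0) (fun=> 0%N) (nth 0 data).

(* [A] row by row, then [b]. *)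
Definition feas_data (R : realType) (m n : nat)
    (A : 'M[R]_(m, n)) (b : 'cV[R]_m) : seq R :=
  [seq A i j | i <- enum 'I_m, j <- enum 'I_n] ++ [seq b i 0 | i <- enum 'I_m].

Definition feas_input (R : realType) (m n : nat)
    (A : 'M[R]_(m, n)) (b : 'cV[R]_m) : config R :=
  init m n (feas_data A b).

Definition opt_input (R : realType) (m n : nat)
    (A : 'M[R]_(m, n)) (b : 'cV[R]_m) (c : 'cV[R]_n) : config R :=
  init m n (feas_data A b ++ [seq c j 0 | j <- enum 'I_n]).

Definition feasible (R : realType) (m n : nat)
    (A : 'M[R]_(m, n)) (b : 'cV[R]_m) (x : 'cV[R]_n) : Prop :=
  (forall j, x j 0 = 0 \/ x j 0 = 1) /\ A *m x = b.

Definition objective (R : realType) (n : nat) (c x : 'cV[R]_n) : R :=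
  (c^T *m x) 0 0.

(* Output: integer register 0 holds 1 or 0 (solution found / none exists), the
   first [n] cells of the integer memory hold the solution, and for the
   optimization problem real register 0 holds the minimum value. *)
Definition output (R : realType) (n : nat) (s : config R) : 'cV[R]_n :=
  \col_(j < n) (imem s j)%:R.

Definition solves_feasibility (R : realType) (P : program) : Prop :=
  forall (m n : nat) (A : 'M[R]_(m, n)) (b : 'cV[R]_m),
  exists (t : nat) (s : config R), run P (feas_input A b) t s /\
    ((ireg s 0%N = 1%N /\ feasible A b (output n s)) \/
     (ireg s 0%N = 0%N /\ forall x, ~ feasible A b x)).

Definition solves_optimization (R : realType) (P : program) : Prop :=
  forall (m n : nat) (A : 'M[R]_(m, n)) (b : 'cV[R]_m) (c : 'cV[R]_n),
  exists (t : nat) (s : config R), run P (opt_input A b c) t s /\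
    ((ireg s 0%N = 1%N /\
      [/\ feasible A b (output n s),
          rreg s 0%N = objective c (output n s) &
          forall y, feasible A b y -> objective c (output n s) <= objective c y]) \/
     (ireg s 0%N = 0%N /\ forall x, ~ feasible A b x)).

(* [m 2^(n/2) p(n)]. Polynomials with coefficients in [nat] dominate all real
   polynomials on the naturals and absorb the constants of the O-notation. *)
Definition time_bound (R : realType) (p : {poly nat}) (m n : nat) : R :=
  m%:R * 2 `^ (n%:R / 2) * (p.[n])%:R.

(* The standing assumption that [m] is polynomially bounded in [n] is the
   quantification over [q]. The running time is bounded for [0 < m] only, since
   [m 2^(n/2) p(n)] vanishes at [m = 0]. *)
Definition feasibility_in_time (R : realType) (P : program) : Prop :=
  forall q : {poly nat}, exists p : {poly nat},
  forall (m n : nat) (A : 'M[R]_(m, n)) (b : 'cV[R]_m) (t : nat) (s : config R),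
  (0 < m)%N -> (m <= q.[n])%N ->
  run P (feas_input A b) t s -> t%:R <= time_bound R p m n.

Definition optimization_in_time (R : realType) (P : program) : Prop :=
  forall q : {poly nat}, exists p : {poly nat},
  forall (m n : nat) (A : 'M[R]_(m, n)) (b : 'cV[R]_m) (c : 'cV[R]_n)
         (t : nat) (s : config R),
  (0 < m)%N -> (m <= q.[n])%N ->
  run P (opt_input A b c) t s -> t%:R <= time_bound R p m n.

(* Main.v *)
(** Meet in the middle, after Horowitz and Sahni. To a set S of columns with
    indicator vector x attach the vector (A x, c x, x) of length K = m + 1 + n,
    and order these vectors lexicographically. The order is invariant under
    translations, so merging a sorted list of the subsets of T with its
    translate by column j gives, in linear time, a sorted list of the subsets of
    T + j. The columns go alternately to two lists, which therefore have at most
    2^((n+1)/2) entries each. To find two entries whose sum is b on the first m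
    coordinates, one pointer ascends in the first list while another descends in
    the second. Coordinate m holds the objective, so at a hit the entry of the
    first list is the cheapest among the later ones with the same key, and the
    second pointer can move on. Without an objective the same program solves the
    feasibility problem, because the memory cells of c then hold zeros. *)

Require Import Defs.
From mathcomp Require Import all_boot all_order all_algebra.
From mathcomp Require Import reals exp.
From mathcomp Require Import zify ring.

Set Implicit Arguments.
Unset Strict Implicit.
Unset Printing Implicit Defensive.

Import Order.TTheory GRing.Theory Num.Theory.

Local Open Scope ring_scope.

(** * Structured programs and their compilation *)

(** The statement charges single machine instructions, so correctness and cost are proved together,
    for structured commands with a step budget, and the translation to jumps is verified once. What
    a command leaves unchanged is read off from its text.

    Cells of the real memory are never reused: columns and lists are written above everything stored
    before, where all cells are still zero. The [K] zero cells just past the input are at once the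
    zero summand in comparisons and copies and the entry of the empty set with which both lists
    start. Carrying the indicator vector in each entry replaces back pointers: in the two winning
    entries these coordinates add up to the solution. They come last in the order, so they only
    break ties and disturb neither keys nor costs.

    Alternating the columns balances the lists without ever halving [n]. Rounding [n/2] up costs a
    constant factor in the final bound. *)

Inductive cmd : Type :=
| Blk of seq instr
| Seq of cmd & cmd
| IfI of nat & nat & cmd & cmd
| IfR of nat & nat & cmd & cmd
| While of nat & nat & cmd.

(** Jump targets are absolute, hence the load address [l]. A conditional jump is taken when [<=]
    holds, so the second branch of a conditional is laid out first, and a loop leaves by the
    reversed test [y <= x]. *)
Fixpoint compile (l : nat) (c : cmd) : program :=
  match c with
  | Blk ops => ops
  | Seq c1 c2 => let p := compile l c1 in p ++ compile (l + size p) c2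
  | IfI x y c1 c2 =>
      let p2 := compile l.+1 c2 in let l1 := (l + (size p2).+2)%N in
      let p1 := compile l1 c1 in
      JumpILe x y l1 :: p2 ++ Jump (l1 + size p1) :: p1
  | IfR x y c1 c2 =>
      let p2 := compile l.+1 c2 in let l1 := (l + (size p2).+2)%N in
      let p1 := compile l1 c1 in
      JumpRLe x y l1 :: p2 ++ Jump (l1 + size p1) :: p1
  | While x y c1 =>
      let p := compile l.+1 c1 in
      JumpILe y x (l + (size p).+2) :: rcons p (Jump l)
  end.

Definition straight (i : instr) : bool :=
  match i with Jump _ | JumpILe _ _ _ | JumpRLe _ _ _ => false | _ => true end.

Fixpoint wf (c : cmd) : bool :=
  match c with
  | Blk ops => all straight ops
  | Seq c1 c2 | IfI _ _ c1 c2 | IfR _ _ c1 c2 => wf c1 && wf c2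
  | While _ _ c1 => wf c1
  end.

Section Semantics.
Variable R : realType.
Implicit Types (s : config R) (c : cmd) (Q : config R -> Prop).

(* The program counters of the configurations are irrelevant here. *)
Inductive ev : cmd -> config R -> nat -> config R -> Prop :=
| ev_blk ops s : ev (Blk ops) s (size ops) (foldl (fun s i => exec i s) s ops)
| ev_seq c1 c2 s t1 s1 t2 s2 :
    ev c1 s t1 s1 -> ev c2 s1 t2 s2 -> ev (Seq c1 c2) s (t1 + t2) s2
| ev_ifI_le x y c1 c2 s t s' : (ireg s x <= ireg s y)%N ->
    ev c1 s t s' -> ev (IfI x y c1 c2) s t.+1 s'
| ev_ifI_gt x y c1 c2 s t s' : (ireg s y < ireg s x)%N ->
    ev c2 s t s' -> ev (IfI x y c1 c2) s t.+2 s'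
| ev_ifR_le x y c1 c2 s t s' : rreg s x <= rreg s y ->
    ev c1 s t s' -> ev (IfR x y c1 c2) s t.+1 s'
| ev_ifR_gt x y c1 c2 s t s' : rreg s y < rreg s x ->
    ev c2 s t s' -> ev (IfR x y c1 c2) s t.+2 s'
| ev_while_done x y c s : (ireg s y <= ireg s x)%N -> ev (While x y c) s 1 s
| ev_while_step x y c s t1 s1 t2 s2 : (ireg s x < ireg s y)%N ->
    ev c s t1 s1 -> ev (While x y c) s1 t2 s2 ->
    ev (While x y c) s (t1 + t2).+2 s2.

Definition setpc (l : nat) s : config R :=
  Config l (ireg s) (rreg s) (imem s) (rmem s).

Definition code_at (P : program) (l : nat) (p : program) : Prop :=
  exists pre post, P = pre ++ p ++ post /\ size pre = l.

Lemma code_at_refl P : code_at P 0 P.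
Proof. by exists [::], [::]; rewrite cats0. Qed.

Lemma code_at_catl P l p1 p2 : code_at P l (p1 ++ p2) -> code_at P l p1.
Proof. by case=> pre [post [-> <-]]; exists pre, (p2 ++ post); rewrite -!catA. Qed.

Lemma code_at_catr P l p1 p2 :
  code_at P l (p1 ++ p2) -> code_at P (l + size p1) p2.
Proof.
case=> pre [post [-> <-]]; exists (pre ++ p1), post.
by rewrite !catA size_cat.
Qed.

Lemma code_at_cons P l i p : code_at P l (i :: p) -> code_at P l.+1 p.
Proof. by move/(@code_at_catr _ _ [:: i]); rewrite addn1. Qed.

Lemma code_at_head P l i p : code_at P l (i :: p) -> onth P l = Some i.
Proof. by case=> pre [post [-> <-]]; rewrite onth_cat ltnn subnn. Qed.

Lemma exec_setpc i l s : straight i -> exec i (setpc l s) = setpc l.+1 (exec i s).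
Proof. by case: i; case: s. Qed.

(** [run] describes only executions up to halting, so a fragment inside a program is specified by
    what it prepends to an arbitrary run from its end. In this form sequencing and iteration need no
    concatenation of runs. *)
Lemma compile_run c s t s' : ev c s t s' -> wf c ->
  forall P l t2 s2, code_at P l (compile l c) ->
  run P (setpc (l + size (compile l c)) s') t2 s2 ->
  run P (setpc l s) (t + t2) s2.
Proof.
elim=> {c s t s'} /=.
- move=> ops s st P l t2 s2; elim: ops s l st => [|i ops IH] s l /=.
    by rewrite addn0.
  case/andP=> si st ca; rewrite -addSnnS addSn => r.
  apply: (run_step (i := i)); first exact: code_at_head ca.
  by rewrite exec_setpc //; apply: IH => //; apply: code_at_cons ca.
- move=> c1 c2 s t1 s1 t2 s2 _ IH1 _ IH2 /andP[w1 w2] P l t3 s3 ca.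
  rewrite size_cat addnA => r; rewrite -addnA.
  apply: IH1 => //; first exact: code_at_catl ca.
  by apply: IH2 => //; apply: code_at_catr ca.
- move=> x y c1 c2 s t s' le _ IH /andP[w1 w2] P l t2 s2 ca r.
  rewrite !addSn; apply: (run_step (i := JumpILe x y (l + (size (compile l.+1 c2)).+2))).
    exact: code_at_head ca.
  rewrite /= le; apply: IH => //.
    have := code_at_catr (code_at_cons ca) => /code_at_cons.
    by rewrite !addnS !addSn.
  move: r; rewrite size_cat /=.
  by congr (run _ (setpc _ _) _ _); lia.
- move=> x y c1 c2 s t s' gt _ IH /andP[w1 w2] P l t2 s2 ca r.
  rewrite !addSn; apply: (run_step (i := JumpILe x y (l + (size (compile l.+1 c2)).+2))).
    exact: code_at_head ca.
  rewrite /= leqNgt gt /= -addnS; apply: IH => //.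
    exact: code_at_catl (code_at_cons ca).
  apply: run_step.
    exact: code_at_head (code_at_catr (code_at_cons ca)).
  move: r; rewrite size_cat /=.
  by congr (run _ (setpc _ _) _ _); lia.
- move=> x y c1 c2 s t s' le _ IH /andP[w1 w2] P l t2 s2 ca r.
  rewrite !addSn; apply: (run_step (i := JumpRLe x y (l + (size (compile l.+1 c2)).+2))).
    exact: code_at_head ca.
  rewrite /= le; apply: IH => //.
    have := code_at_catr (code_at_cons ca) => /code_at_cons.
    by rewrite !addnS !addSn.
  move: r; rewrite size_cat /=.
  by congr (run _ (setpc _ _) _ _); lia.
- move=> x y c1 c2 s t s' gt _ IH /andP[w1 w2] P l t2 s2 ca r.
  rewrite !addSn; apply: (run_step (i := JumpRLe x y (l + (size (compile l.+1 c2)).+2))).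
    exact: code_at_head ca.
  rewrite /= leNgt gt /= -addnS; apply: IH => //.
    exact: code_at_catl (code_at_cons ca).
  apply: run_step.
    exact: code_at_head (code_at_catr (code_at_cons ca)).
  move: r; rewrite size_cat /=.
  by congr (run _ (setpc _ _) _ _); lia.
- move=> x y c s le w P l t2 s2 ca r.
  rewrite addSn; apply: run_step; first exact: code_at_head ca.
  rewrite /= le; move: r; rewrite size_rcons.
  by congr (run _ (setpc _ _) _ _); lia.
- move=> x y c s t1 s1 t2 s2 lt _ IH1 _ IH2 w P l t3 s3 ca r.
  rewrite !addSn; apply: run_step; first exact: code_at_head ca.
  rewrite /= leqNgt lt /=.
  have ca1 := code_at_cons ca; rewrite -cats1 in ca1.
  suff: run P (setpc l.+1 s) (t1 + (t2 + t3).+1) s3.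
    by rewrite addnS addnA.
  apply: IH1 => //; first exact: code_at_catl ca1.
  apply: run_step; first exact: code_at_head (code_at_catr ca1).
  exact: IH2.
Qed.

Lemma run_compile c s t s' : ev c s t s' -> wf c ->
  run (compile 0 c) (setpc 0 s) t (setpc (size (compile 0 c)) s').
Proof.
move=> e w; rewrite -[t]addn0; apply: compile_run e w _ _ _ _ (code_at_refl _) _.
by apply: run_halt; rewrite onth_default.
Qed.

(** Determinism carries the bound for the one run that is constructed over to all runs that the time
    requirement quantifies over. *)
Lemma run_functional P s t1 s1 t2 s2 :
  run P s t1 s1 -> run P s t2 s2 -> t1 = t2.
Proof.
move=> r; elim: r t2 s2 => {s t1 s1} [s h|i s t1 s1 h _ IH] t2 s2 r.
  by case: r h => // i {}s t s' ->.
case: r h IH => {s t2 s2} [s ->//|j s t s' ->] r [<-] IH.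
by congr S; apply: IH r.
Qed.

(** Total correctness with a budget. [T] is an upper bound rather than the exact count, so that
    branches of different lengths can share it. *)
Definition wp c (T : nat) Q s : Prop :=
  exists t s', [/\ ev c s t s', (t <= T)%N & Q s'].

Lemma wp_conseq c T T' Q Q' s : (T <= T')%N -> (forall s', Q s' -> Q' s') ->
  wp c T Q s -> wp c T' Q' s.
Proof.
move=> lT QQ' [t [s' [e le q]]]; exists t, s'; split=> //.
  exact: leq_trans lT.
exact: QQ'.
Qed.

Lemma wp_blk ops T Q s : (size ops <= T)%N ->
  Q (foldl (fun s i => exec i s) s ops) -> wp (Blk ops) T Q s.
Proof. by move=> le q; exists (size ops); eexists; split; [apply: ev_blk| |exact: q]. Qed.

Lemma wp_seq T1 T2 c1 c2 T Q s : (T1 + T2 <= T)%N ->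
  wp c1 T1 (wp c2 T2 Q) s -> wp (Seq c1 c2) T Q s.
Proof.
move=> lT [t1 [s1 [e1 l1 [t2 [s2 [e2 l2 q]]]]]].
exists (t1 + t2)%N, s2; split=> //; first exact: ev_seq e1 e2.
by apply: leq_trans lT; apply: leq_add.
Qed.

Lemma wp_ifI T x y c1 c2 T' Q s : (T.+2 <= T')%N ->
  ((ireg s x <= ireg s y)%N -> wp c1 T Q s) ->
  ((ireg s y < ireg s x)%N -> wp c2 T Q s) ->
  wp (IfI x y c1 c2) T' Q s.
Proof.
move=> lT h1 h2; apply: (wp_conseq lT (fun _ q => q)).
case: (leqP (ireg s x) (ireg s y)) => [le|gt].
  have [t [s' [e l q]]] := h1 le.
  by exists t.+1, s'; split=> //; [apply: ev_ifI_le|apply: leqW].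
have [t [s' [e l q]]] := h2 gt.
by exists t.+2, s'; split=> //; apply: ev_ifI_gt.
Qed.

Lemma wp_ifR T x y c1 c2 T' Q s : (T.+2 <= T')%N ->
  (rreg s x <= rreg s y -> wp c1 T Q s) ->
  (rreg s y < rreg s x -> wp c2 T Q s) ->
  wp (IfR x y c1 c2) T' Q s.
Proof.
move=> lT h1 h2; apply: (wp_conseq lT (fun _ q => q)).
case: (leP (rreg s x) (rreg s y)) => [le|gt].
  have [t [s' [e l q]]] := h1 le.
  by exists t.+1, s'; split=> //; [apply: ev_ifR_le|apply: leqW].
have [t [s' [e l q]]] := h2 gt.
by exists t.+2, s'; split=> //; apply: ev_ifR_gt.
Qed.

(** [k] bounds the remaining rounds and need not be their number, since a loop may leave early. Each
    round pays for its test and the jump back; the strict inequality pays for the last test. *)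
Lemma wp_while (I : nat -> config R -> Prop) k T x y c T' Q s :
  (k * T.+2 < T')%N -> I k s ->
  (forall k s, I k s -> (ireg s y <= ireg s x)%N -> Q s) ->
  (forall s, I 0%N s -> (ireg s y <= ireg s x)%N) ->
  (forall k s, I k.+1 s -> (ireg s x < ireg s y)%N -> wp c T (I k) s) ->
  wp (While x y c) T' Q s.
Proof.
move=> lT Is hQ h0 hS.
suff: wp (While x y c) (k * T.+2).+1 Q s by apply: wp_conseq.
elim: k s Is {lT} => [|k IH] s Is.
  by exists 1%N, s; split; [exact: ev_while_done (h0 _ Is)| |exact: hQ Is (h0 _ Is)].
case: (leqP (ireg s y) (ireg s x)) => [le|lt].
  by exists 1%N, s; split; [exact: ev_while_done| |exact: hQ Is le].
have [t1 [s1 [e1 l1 I1]]] := hS _ _ Is lt.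
have [t2 [s2 [e2 l2 q]]] := IH _ I1.
exists (t1 + t2).+2, s2; split=> //; first exact: ev_while_step e2.
by rewrite mulSn; lia.
Qed.

End Semantics.

(** * Registers and memories that a command can change *)

Definition idst (i : instr) : option nat :=
  match i with
  | IConst d _ | IAdd d _ _ | ISub d _ _ | ILoad d _ => Some d
  | _ => None
  end.

Definition rdst (i : instr) : option nat :=
  match i with
  | RConst d _ | RAdd d _ _ | RSub d _ _ | RMul d _ _ | RDiv d _ _
  | RLoad d _ => Some d
  | _ => None
  end.

Fixpoint instrs (c : cmd) : seq instr :=
  match c with
  | Blk ops => ops
  | Seq c1 c2 | IfI _ _ c1 c2 | IfR _ _ c1 c2 => instrs c1 ++ instrs c2
  | While _ _ c1 => instrs c1
  end.

Definition stores_i (i : instr) := if i is IStore _ _ then true else false.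
Definition stores_r (i : instr) := if i is RStore _ _ then true else false.

Section Frame.
Variable R : realType.

(** For a concrete command the side conditions are settled by evaluation. A memory is treated as a
    whole: it is known to be unchanged only if no instruction stores into it. *)
Definition frame (ops : seq instr) (s s' : config R) : Prop :=
  [/\ forall r, r \notin pmap idst ops -> ireg s' r = ireg s r,
      forall r, r \notin pmap rdst ops -> rreg s' r = rreg s r,
      has stores_i ops \/ imem s' = imem s &
      has stores_r ops \/ rmem s' = rmem s].

Lemma frame_refl ops s : frame ops s s.
Proof. by split=> //; right. Qed.

Lemma frame_cat ops1 ops2 s1 s2 s3 :
  frame ops1 s1 s2 -> frame ops2 s2 s3 -> frame (ops1 ++ ops2) s1 s3.
Proof.
move=> [i1 r1 im1 rm1] [i2 r2 im2 rm2]; split.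
- by move=> r; rewrite pmap_cat mem_cat => /norP[n1 n2]; rewrite i2 ?i1.
- by move=> r; rewrite pmap_cat mem_cat => /norP[n1 n2]; rewrite r2 ?r1.
- by rewrite has_cat; case: im1 => [->|<-]; [left|case: im2 => [->|->];
    [left; rewrite orbT|right]].
- by rewrite has_cat; case: rm1 => [->|<-]; [left|case: rm2 => [->|->];
    [left; rewrite orbT|right]].
Qed.

Lemma frame_exec i s : frame [:: i] s (exec i s).
Proof.
by case: i s => [d k|d x y|d x y|d a|a x|d k|d x y|d x y|d x y|d x y|d a|a x|
    k|x y k|x y k] [l ir rr im rm]; split=> //=; try (by [right|left]);
  move=> r; rewrite inE => /negPf ->.
Qed.

Lemma frame_sub (ops1 ops2 : seq instr) s s' : frame ops1 s s' ->
  {subset pmap idst ops1 <= pmap idst ops2} ->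
  {subset pmap rdst ops1 <= pmap rdst ops2} ->
  (has stores_i ops1 -> has stores_i ops2) ->
  (has stores_r ops1 -> has stores_r ops2) -> frame ops2 s s'.
Proof.
move=> [h1 h2 h3 h4] s1 s2 s3 s4; split.
- by move=> r nr; apply: h1; apply: contra nr; apply: s1.
- by move=> r nr; apply: h2; apply: contra nr; apply: s2.
- by case: h3 => [/s3|]; [left|right].
- by case: h4 => [/s4|]; [left|right].
Qed.

(** Needed for loops, where all rounds share one footprint. *)
Lemma frame_trans ops s1 s2 s3 : frame ops s1 s2 -> frame ops s2 s3 -> frame ops s1 s3.
Proof.
move=> f1 f2; apply: frame_sub (frame_cat f1 f2) _ _ _ _.
- by move=> r; rewrite pmap_cat mem_cat orbb.
- by move=> r; rewrite pmap_cat mem_cat orbb.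
- by rewrite has_cat orbb.
- by rewrite has_cat orbb.
Qed.

Lemma frame_catl ops1 ops2 s s' : frame ops1 s s' -> frame (ops1 ++ ops2) s s'.
Proof. by move=> f; have := frame_cat f (frame_refl ops2 s'). Qed.

Lemma frame_catr ops1 ops2 s s' : frame ops2 s s' -> frame (ops1 ++ ops2) s s'.
Proof. exact: frame_cat (frame_refl ops1 s). Qed.

Lemma ev_frame c (s s' : config R) t : ev c s t s' -> frame (instrs c) s s'.
Proof.
elim=> {c s t s'} /=.
- elim=> [|i ops IH] s /=; first exact: frame_refl.
  exact: frame_cat (frame_exec i s) (IH _).
- by move=> c1 c2 s t1 s1 t2 s2 _ f1 _ f2; apply: frame_cat f1 f2.
- by move=> x y c1 c2 s t s' _ _; apply: frame_catl.
- by move=> x y c1 c2 s t s' _ _; apply: frame_catr.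
- by move=> x y c1 c2 s t s' _ _; apply: frame_catl.
- by move=> x y c1 c2 s t s' _ _; apply: frame_catr.
- by move=> x y c s _; apply: frame_refl.
- move=> x y c s t1 s1 t2 s2 _ _ f1 _ f2.
  exact: frame_trans f1 f2.
Qed.

Lemma wp_frame c T (Q : config R -> Prop) s :
  wp c T (fun s' => frame (instrs c) s s' -> Q s') s -> wp c T Q s.
Proof.
move=> [t [s' [e le q]]]; exists t, s'; split=> //.
exact: q (ev_frame e).
Qed.

End Frame.

(** * Lexicographic comparison *)

Section Lex.
Variable R : realType.
Implicit Types f g h : nat -> R.

(* Lexicographic comparison on the indices below [k]: 0 for [<], 1 for [=],
   2 for [>]. *)
Fixpoint lexc (k : nat) f g : nat :=
  if k is k'.+1 then
    if f 0%N <= g 0%N then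
      if g 0%N <= f 0%N then lexc k' (f \o S) (g \o S) else 0%N
    else 2
  else 1.

Definition lle k f g : bool := (lexc k f g <= 1)%N.

Lemma eq_lexc k f f' g g' :
  (forall i, (i < k)%N -> f i = f' i) -> (forall i, (i < k)%N -> g i = g' i) ->
  lexc k f g = lexc k f' g'.
Proof.
elim: k f f' g g' => //= k IH f f' g g' ef eg.
rewrite ef // eg // (IH _ (f' \o S) _ (g' \o S)) // => i ik.
  exact: (ef i.+1).
exact: (eg i.+1).
Qed.

Lemma lexc_add2r k h f g :
  lexc k (fun i => f i + h i) (fun i => g i + h i) = lexc k f g.
Proof.
elim: k f g h => //= k IH f g h; rewrite !lerD2r.
by do 2![case: ifP => // _]; apply: (IH (f \o S) (g \o S) (h \o S)).
Qed.

Lemma lexc_sym k f g : lexc k g f = (2 - lexc k f g)%N.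
Proof.
elim: k f g => //= k IH f g.
by case: (ltgtP (f 0%N) (g 0%N)) => // _; rewrite IH.
Qed.

(** On the values 0 and 1 the minimum says that a chain of two [<=] is strict as soon as one link
    is. The matching phase needs this sharper form of transitivity. *)
Lemma lexc_trans k f g h : lle k f g -> lle k g h ->
  lexc k f h = minn (lexc k f g) (lexc k g h).
Proof.
rewrite /lle; elim: k f g h => //= k IH f g h.
case: (ltgtP (f 0%N) (g 0%N)) => [fg|//|fg];
  case: (ltgtP (g 0%N) (h 0%N)) => [gh|//|gh] //; rewrite -?gh ?fg ?lexx.
- by rewrite (ltW (lt_trans fg gh)) leNgt (lt_trans fg gh).
- by rewrite (ltW fg) leNgt fg min0n.
- by rewrite (ltW gh) leNgt gh minn0.
- exact: IH.
Qed.

Lemma lle_total k : total (lle k).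
Proof. by move=> f g; rewrite /lle (lexc_sym k f g); lia. Qed.

Lemma lle_trans k : transitive (lle k).
Proof. by move=> g f h fg gh; move: (fg); rewrite /lle (lexc_trans fg gh); lia. Qed.

Lemma lexc_eq1 k f g : (lexc k f g = 1)%N <-> (forall i, (i < k)%N -> f i = g i).
Proof.
split; last first.
  by move=> e; rewrite (eq_lexc e (fun _ _ => erefl)); elim: k g {e} => //= k IH g;
    rewrite lexx.
elim: k f g => //= k IH f g.
case: (ltgtP (f 0%N) (g 0%N)) => // e /IH e' [//|i] /e'; exact.
Qed.

(** Lists sorted on all [K] coordinates are thereby sorted on the [m] coordinates of the key. *)
Lemma lle_prefix k l f g : lle (k + l) f g -> lle k f g.
Proof.
rewrite /lle; elim: k f g => //= k IH f g.
by case: (ltgtP (f 0%N) (g 0%N)) => // _; apply: IH.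
Qed.

(** Used with [k = m]: among entries with equal keys the objective decides. *)
Lemma lle_next k l f g : lle (k.+1 + l) f g ->
  (forall i, (i < k)%N -> f i = g i) -> f k <= g k.
Proof.
move=> /lle_prefix; rewrite /lle; elim: k f g => [|k IH] f g.
  by move=> /= h _; move: h; case: leP.
move=> /= h e; move: h; rewrite (e 0%N) // lexx => /IH; apply=> i ik.
exact: (e i.+1).
Qed.

End Lex.

(** * Addresses of the input entries *)

Lemma size_map_enum T p (f : 'I_p -> T) : size [seq f i | i <- enum 'I_p] = p.
Proof. by rewrite size_map size_enum_ord. Qed.

Section Data.
Variables (R : realType) (m n : nat) (A : 'M[R]_(m, n)) (b : 'cV[R]_m)
          (tl : seq R).

Let data := feas_data A b ++ tl.

Lemma size_allpairs_enum : size [seq A i j | i <- enum 'I_m, j <- enum 'I_n] = (m * n)%N.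
Proof. by rewrite size_allpairs !size_enum_ord. Qed.

Lemma nth_data_A (i : 'I_m) (j : 'I_n) : nth 0 data (j + i * n) = A i j.
Proof.
have lt : (j + i * n < m * n)%N.
  by have := ltn_ord i; have := ltn_ord j; nia.
rewrite /data /feas_data !nth_cat !size_cat size_allpairs_enum lt ltn_addr //.
rewrite /allpairs_dep.
have -> (s : seq 'I_m) k : (k < size s)%N ->
    nth 0 (flatten [seq [seq A i j | j <- enum 'I_n] | i <- s]) (j + k * n) =
      A (nth i s k) j.
  elim: s k => //= i0 s IH [|k] lk; rewrite nth_cat size_map size_enum_ord.
    by rewrite mul0n addn0 ltn_ord (nth_map j) ?size_enum_ord // nth_ord_enum.
  by rewrite ltnNge mulSn addnCA leq_addr /= addKn IH.
  by rewrite nth_ord_enum.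
by rewrite size_enum_ord.
Qed.

Lemma nth_data_b (i : 'I_m) : nth 0 data (m * n + i) = b i 0.
Proof.
rewrite /data /feas_data !nth_cat !size_cat size_allpairs_enum size_map size_enum_ord.
rewrite ltn_add2l ltn_ord ltnNge leq_addr /= addKn.
by rewrite (nth_map i) ?size_enum_ord // nth_ord_enum.
Qed.

Lemma size_feas_data : size (feas_data A b) = (m * n + m)%N.
Proof. by rewrite /feas_data size_cat size_allpairs_enum size_map_enum. Qed.

End Data.

(* [rZero] and the real register 4 are never written, hence contain 0. *)
Notation rM := 0%N (only parsing).
Notation rN := 1%N (only parsing).
Notation rOne := 2%N (only parsing).
Notation rK := 3%N (only parsing).
Notation rD := 4%N (only parsing).
Notation rZ := 5%N (only parsing).
Notation rS1 := 6%N (only parsing).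
Notation rE1 := 7%N (only parsing).
Notation rS2 := 8%N (only parsing).
Notation rE2 := 9%N (only parsing).
Notation rTop := 10%N (only parsing).
Notation rJ := 11%N (only parsing).
Notation rU1 := 12%N (only parsing).
Notation rU2 := 13%N (only parsing).
Notation rU3 := 14%N (only parsing).
Notation rU4 := 15%N (only parsing).
Notation rCnt := 16%N (only parsing).
Notation rFlag := 17%N (only parsing).
Notation rP := 18%N (only parsing).
Notation rQ := 19%N (only parsing).
Notation rO := 20%N (only parsing).
Notation rFound := 21%N (only parsing).
Notation rBP := 22%N (only parsing).
Notation rBQ := 23%N (only parsing).
Notation rStop := 24%N (only parsing).
Notation rZero := 25%N (only parsing).
Notation rT := 26%N (only parsing).
Notation copy d x := (IAdd d x rZero) (only parsing).

(** Each side is a sum of two vectors, so that one routine serves both phases: merging compares an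
    entry plus the zero vector with an entry plus the new column, matching compares a sum of two
    entries with [b] plus zeros. Setting [rCnt] to 0 leaves the loop early. *)
Definition compare_cmd : cmd :=
  Seq (Blk [:: IConst rFlag 1])
  (While rZero rCnt
    (Seq (Blk [:: RLoad 1 rU1; RLoad 2 rU2; RAdd 1 1 2;
                  RLoad 2 rU3; RLoad 3 rU4; RAdd 2 2 3])
    (IfR 1 2
      (IfR 2 1
        (Blk [:: IAdd rU1 rU1 rOne; IAdd rU2 rU2 rOne; IAdd rU3 rU3 rOne;
                 IAdd rU4 rU4 rOne; ISub rCnt rCnt rOne])
        (Blk [:: IConst rFlag 0; IConst rCnt 0]))
      (Blk [:: IConst rFlag 2; IConst rCnt 0])))).

Section Specs.
Variable R : realType.
Implicit Types (s : config R) (Q : config R -> Prop).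

Definition ready s : Prop := ireg s rZero = 0%N /\ ireg s rOne = 1%N.

Definition add_at (rm : nat -> R) (a a' : nat) : nat -> R :=
  fun i => rm (a + i)%N + rm (a' + i)%N.

Lemma wp_compare s k Q : ready s -> ireg s rCnt = k ->
  (forall s', frame (instrs compare_cmd) s s' ->
     ireg s' rFlag = lexc k (add_at (rmem s) (ireg s rU1) (ireg s rU2))
                            (add_at (rmem s) (ireg s rU3) (ireg s rU4)) ->
     Q s') ->
  wp compare_cmd (k * 17 + 2) Q s.
Proof.
case: s => l0 ir0 rr0 im0 rm0 [/= z0 o1] ck hQ; apply: wp_frame.
move: hQ; move defT: (lexc _ _ _) => T hQ.
apply: (wp_seq (T1 := 1) (T2 := (k * 17).+1)); first by lia.
apply: wp_blk => //.
(* While [rCnt] is positive, all coordinates read so far agreed, and comparing the remaining ones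
   still yields the overall result [T]. Once it is 0, [rFlag] holds [T]. *)
pose I k s' := [/\ ready s', rmem s' = rm0, (ireg s' rCnt <= k)%N &
   if ireg s' rCnt == 0%N then ireg s' rFlag = T else
   ireg s' rFlag = 1%N /\ lexc (ireg s' rCnt) (add_at rm0 (ireg s' rU1) (ireg s' rU2))
                            (add_at rm0 (ireg s' rU3) (ireg s' rU4)) = T].
apply: (wp_while (I := I) (k := k) (T := 15)) => //.
- split=> //=; rewrite ?ck //.
  by case: eqP => // k0; rewrite -defT k0.
- move=> k' s' [[-> _] _ _ h]; rewrite leqn0 => c0; rewrite c0 in h.
  by move=> f; apply: hQ.
- by move=> s' [[-> _] _ c0 _].
- move=> k' [l ir rr im rm] [[/= z1 o2] -> le h] c0.
  apply: (wp_seq (T1 := 6) (T2 := 9)) => //.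
  apply: wp_blk => //=; rewrite /add_at in h *.
  rewrite /= z1 in c0; move: h; rewrite (gtn_eqF c0).
  case=> fl1; case E: (ir 16) => [|c] /=; first by rewrite E in c0.
  rewrite !addn0 => hT.
  apply: (wp_ifR (T := 7)) => //= h1.
    apply: (wp_ifR (T := 5)) => //= h2.
      rewrite h1 h2 in hT.
      apply: wp_blk => //=; split=> //=.
        by move: le; rewrite o2 E; lia.
      rewrite E o2 subn1 /=.
      have hh : lexc c
          (fun i => rm0 (ir 12 + 1 + i)%N + rm0 (ir 13 + 1 + i)%N)
          (fun i => rm0 (ir 14 + 1 + i)%N + rm0 (ir 15 + 1 + i)%N) = T.
        by rewrite -hT; apply: eq_lexc => i _ /=; rewrite -!addnA.
      by case: eqP hh => [->|_] //= <-.
    rewrite h1 leNgt h2 /= in hT.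
    by apply: wp_blk => //=; split.
  rewrite leNgt h1 /= in hT.
  by apply: wp_blk => //=; split.
Qed.

End Specs.

(** * Merging *)

Definition write_sum_cmd : cmd :=
  While rZero rCnt
    (Blk [:: RLoad 1 rU1; RLoad 2 rU2; RAdd 1 1 2; RStore rO 1;
             IAdd rU1 rU1 rOne; IAdd rU2 rU2 rOne; IAdd rO rO rOne;
             ISub rCnt rCnt rOne]).

(** The matrix is stored row by row, hence the stride [rN] of the reading address. *)
Definition gather_cmd : cmd :=
  While rZero rCnt
    (Blk [:: RLoad 1 rU2; RStore rU1 1; IAdd rU1 rU1 rOne; IAdd rU2 rU2 rN;
             ISub rCnt rCnt rOne]).

Section Specs.
Variable R : realType.
Implicit Types (s : config R) (Q : config R -> Prop).

(** Both sources end at or before the output address, so no source cell is overwritten. *)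
Lemma wp_write_sum s k Q : ready s -> ireg s rCnt = k ->
  (ireg s rU1 + k <= ireg s rO)%N -> (ireg s rU2 + k <= ireg s rO)%N ->
  (forall s', frame (instrs write_sum_cmd) s s' ->
     ireg s' rO = (ireg s rO + k)%N ->
     (forall i, (i < k)%N -> rmem s' (ireg s rO + i)%N =
        add_at (rmem s) (ireg s rU1) (ireg s rU2) i) ->
     (forall x, (x < ireg s rO)%N || (ireg s rO + k <= x)%N ->
        rmem s' x = rmem s x) ->
     Q s') ->
  wp write_sum_cmd (k * 10).+1 Q s.
Proof.
case: s => l0 ir0 rr0 im0 rm0 [/= z0 o1] ck /= h1 h2 hQ; apply: wp_frame.
pose I j s' := [/\ ready s', ireg s' rCnt = j, (j <= k)%N,
  [/\ ireg s' rU1 = (ir0 rU1 + (k - j))%N, ireg s' rU2 = (ir0 rU2 + (k - j))%N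
    & ireg s' rO = (ir0 rO + (k - j))%N] &
  forall x, rmem s' x = if (ir0 rO <= x < ir0 rO + (k - j))%N then
    rm0 (ir0 rU1 + (x - ir0 rO))%N + rm0 (ir0 rU2 + (x - ir0 rO))%N else rm0 x].
apply: (wp_while (I := I) (k := k) (T := 8)) => //.
- split=> //=; first by rewrite subnn !addn0.
  by move=> x; rewrite subnn addn0; case: ifP => // /andP[]; lia.
- move=> j s' [[z1 _] cj _ [_ _ e3] rm1]; rewrite z1 cj leqn0 => /eqP j0 f.
  rewrite j0 subn0 in rm1 e3; apply: hQ => //.
    move=> i ik; rewrite rm1 ifT; first by rewrite addKn.
    by rewrite leq_addr ltn_add2l.
  by move=> x hx; rewrite rm1 ifF //; lia.
- by move=> s' [[-> _] -> _ _ _].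
- move=> j [l ir rr im rm] [[/= z1 o2] cj lj [e1 e2 e3] rm1] _.
  apply: wp_blk => //=; split=> //=; rewrite ?o2 ?cj ?e1 ?e2 ?e3; try lia.
    by split; lia.
  move=> x; rewrite !rm1.
  case: (x =P _) => [->|nx].
    rewrite [X in X + _]ifF; last lia.
    rewrite [X in _ + X]ifF; last lia.
    by rewrite ifT; [congr (rm0 _ + rm0 _); lia|lia].
  by do 2!case: ifP => //; lia.
Qed.

Lemma wp_gather s k Q : ready s -> ireg s rCnt = k ->
  (forall i, (i < k)%N -> (ireg s rU2 + i * ireg s rN < ireg s rU1)%N) ->
  (forall s', frame (instrs gather_cmd) s s' ->
     ireg s' rU1 = (ireg s rU1 + k)%N ->
     ireg s' rU2 = (ireg s rU2 + k * ireg s rN)%N ->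
     (forall i, (i < k)%N -> rmem s' (ireg s rU1 + i)%N =
        rmem s (ireg s rU2 + i * ireg s rN)%N) ->
     (forall x, (x < ireg s rU1)%N || (ireg s rU1 + k <= x)%N ->
        rmem s' x = rmem s x) ->
     Q s') ->
  wp gather_cmd (k * 7).+1 Q s.
Proof.
case: s => l0 ir0 rr0 im0 rm0 [/= z0 o1] ck /= h1 hQ; apply: wp_frame.
pose I j s' := [/\ ready s', ireg s' rCnt = j, (j <= k)%N,
  [/\ ireg s' rU1 = (ir0 rU1 + (k - j))%N,
      ireg s' rU2 = (ir0 rU2 + (k - j) * ir0 rN)%N & ireg s' rN = ir0 rN] &
  forall x, rmem s' x = if (ir0 rU1 <= x < ir0 rU1 + (k - j))%N then
    rm0 (ir0 rU2 + (x - ir0 rU1) * ir0 rN)%N else rm0 x].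
apply: (wp_while (I := I) (k := k) (T := 5)) => //.
- split=> //=; first by rewrite subnn !addn0.
  by move=> x; rewrite subnn addn0; case: ifP => // /andP[]; lia.
- move=> j s' [[z1 _] cj _ [e1 e2 _] rm1]; rewrite z1 cj leqn0 => /eqP j0 f.
  rewrite j0 subn0 in rm1 e1 e2; apply: hQ => //.
    move=> i ik; rewrite rm1 ifT; first by rewrite addKn.
    by rewrite leq_addr ltn_add2l.
  by move=> x hx; rewrite rm1 ifF //; lia.
- by move=> s' [[-> _] -> _ _ _].
- move=> j [l ir rr im rm] [[/= z1 o2] cj lj [e1 e2 e3] rm1] _.
  have kj : (k - j = (k - j.+1).+1)%N by lia.
  apply: wp_blk => //=; split=> //=; rewrite ?o2 ?cj ?e1 ?e2 ?e3 ?kj; try lia.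
    by split=> //; [lia|rewrite mulSn; lia].
  move=> x; rewrite !rm1.
  have lt := h1 (k - j.+1)%N ltac:(lia).
  case: (x =P _) => [->|nx].
    rewrite ifF; last lia.
    by rewrite ifT; [congr (rm0 _); rewrite addKn|lia].
  by do 2!case: ifP => //; lia.
Qed.

End Specs.

(** Both pointers run through the same list and share the end [rE1]. With a pointer at the end, the
    comparison has read cells outside the list, and its verdict is overridden. *)
Definition pick_cmd : cmd :=
  Seq (IfI rE1 rP (Blk [:: IConst rFlag 2]) (Blk [::]))
  (Seq (IfI rE1 rQ (Blk [:: IConst rFlag 0]) (Blk [::]))
  (IfI rFlag rOne
    (Blk [:: copy rU1 rP; copy rU2 rZ; copy rCnt rK; IAdd rP rP rK])
    (Blk [:: copy rU1 rQ; copy rU2 rTop; copy rCnt rK; IAdd rQ rQ rK]))).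

(** The translated list is never stored: its head is formed as the entry at [rQ] plus the column at
    [rTop]. Adding the zero vector at [rZ] makes copying an untranslated entry the same
    operation. *)
Definition merge_step_cmd : cmd :=
  Seq (Blk [:: copy rU1 rP; copy rU2 rZ; copy rU3 rQ; copy rU4 rTop;
               copy rCnt rK])
  (Seq compare_cmd (Seq pick_cmd write_sum_cmd)).

Definition merge_cmd : cmd := While rO rStop merge_step_cmd.

Section Merge.
Variables (R : realType) (X : Type) (x0 : X) (val : X -> nat -> R) (K : nat).
Implicit Types (s : config R) (Q : config R -> Prop).

Definition stored (rm : nat -> R) (base : nat) (v : seq X) : Prop :=
  forall k i, (k < size v)%N -> (i < K)%N ->
    rm (base + k * K + i)%N = val (nth x0 v k) i.

Definition leX (x y : X) : bool := lle K (val x) (val y).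

Lemma stored_rcons rm base v x : stored rm base v ->
  (forall i, (i < K)%N -> rm (base + size v * K + i)%N = val x i) ->
  stored rm base (rcons v x).
Proof.
move=> h hx k i; rewrite size_rcons ltnS nth_rcons leq_eqVlt.
by case: eqP => [->|_ /= lt]; [rewrite ltnn; move=> _; apply: hx|rewrite lt; apply: h].
Qed.

Lemma eq_stored rm rm' base v :
  (forall x, (base <= x < base + size v * K)%N -> rm' x = rm x) ->
  stored rm base v -> stored rm' base v.
Proof.
move=> e h k i lk li; rewrite e ?h //.
have : (k.+1 * K <= size v * K)%N by rewrite leq_mul2r lk orbT.
by rewrite mulSn; lia.
Qed.

Lemma drop_nth_map (Y : Type) (f : X -> Y) k (v : seq X) : (k < size v)%N ->
  map f (drop k v) = f (nth x0 v k) :: map f (drop k.+1 v).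
Proof. by move=> lt; rewrite (drop_nth x0). Qed.

Lemma wp_pick s Q : ready s ->
  (forall s', frame (instrs pick_cmd) s s' ->
    let: (p, q) := (ireg s rP, ireg s rQ) in
    ireg s' rCnt = ireg s rK ->
    (if (ireg s rE1 <= q)%N || (p < ireg s rE1)%N && (ireg s rFlag <= 1)%N then
       [/\ ireg s' rU1 = p, ireg s' rU2 = ireg s rZ,
           ireg s' rP = (p + ireg s rK)%N & ireg s' rQ = q]
     else
       [/\ ireg s' rU1 = q, ireg s' rU2 = ireg s rTop,
           ireg s' rP = p & ireg s' rQ = (q + ireg s rK)%N]) -> Q s') ->
  wp pick_cmd 12 Q s.
Proof.
case: s => l ir rr im rm [/= z0 o1] hQ; apply: wp_frame; move: hQ.
set b := (_ || _) => hQ.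
apply: (wp_seq (T1 := 3) (T2 := 9)) => //.
apply: (wp_ifI (T := 1)) => //= h1; apply: wp_blk => //=;
apply: (wp_seq (T1 := 3) (T2 := 6)) => //;
apply: (wp_ifI (T := 1)) => //= h2; apply: wp_blk => //=;
apply: (wp_ifI (T := 4)) => //=; rewrite ?o1 // => h3; apply: wp_blk => //= f;
apply: hQ => //=; rewrite ?z0 ?addn0 //.
all: by rewrite /b; (case: ifP => //; lia).
Qed.

Lemma merge_consl (le : rel X) x v w :
  (if w is y :: _ then le x y else true) ->
  merge le (x :: v) w = x :: merge le v w.
Proof. by case: w => [_|y w /= ->] //; case: v. Qed.

Lemma merge_consr (le : rel X) y v w :
  (if v is x :: _ then ~~ le x y else true) ->
  merge le v (y :: w) = y :: merge le v w.
Proof. by case: v => //= x v /negPf ->. Qed.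

Lemma wp_merge_step s v F base ia ib d Q : ready s -> (0 < K)%N -> ireg s rK = K ->
  let rm := rmem s in let a := ireg s rTop in let o := ireg s rO in
  stored rm base v -> (base + size v * K <= o)%N ->
  (forall i, (i < K)%N -> rm (ireg s rZ + i)%N = 0) ->
  (ireg s rZ + K <= o)%N -> (a + K <= o)%N ->
  (forall k i, (k < size v)%N -> (i < K)%N ->
     val (F (nth x0 v k)) i = val (nth x0 v k) i + rm (a + i)%N) ->
  ireg s rE1 = (base + size v * K)%N ->
  (ia <= size v)%N -> (ib <= size v)%N -> (ia + ib < size v + size v)%N ->
  ireg s rP = (base + ia * K)%N -> ireg s rQ = (base + ib * K)%N ->
  d ++ merge leX (drop ia v) (map F (drop ib v)) = merge leX v (map F v) ->
  (forall s' ia' ib' x, frame (instrs merge_step_cmd) s s' ->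
     (ia' <= size v)%N -> (ib' <= size v)%N -> (ia' + ib' = (ia + ib).+1)%N ->
     ireg s' rP = (base + ia' * K)%N -> ireg s' rQ = (base + ib' * K)%N ->
     rcons d x ++ merge leX (drop ia' v) (map F (drop ib' v)) =
       merge leX v (map F v) ->
     ireg s' rO = (o + K)%N ->
     (forall i, (i < K)%N -> rmem s' (o + i)%N = val x i) ->
     (forall x, (x < o)%N || (o + K <= x)%N -> rmem s' x = rm x) -> Q s') ->
  wp merge_step_cmd (K * 27 + 24) Q s.
Proof.
case: s => l ir rr im rm [/= z0 o1] K0 kK hv ho hz hzo hao hF hE1 ha hb hab.
move=> hP hQ hd hpost.
apply: wp_frame.
apply: (wp_seq (T1 := 5) (T2 := K * 27 + 19)); first lia.
apply: wp_blk => //=.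
apply: (wp_seq (T1 := K * 17 + 2) (T2 := K * 10 + 17)); first lia.
apply: wp_compare => //=; first by rewrite z0 kK addn0.
move=> s1 [fi1 _ _ [//|rm1]]; rewrite /= in rm1; rewrite z0 !addn0 => hfl.

apply: (wp_seq (T1 := 12) (T2 := (K * 10).+1)); first lia.
apply: wp_pick => [|s2 [fi2 _ _ [//|rm2]]].
  by split; rewrite fi1.
rewrite rm1 in rm2.
rewrite (fi1 rK) // (fi1 rE1) // (fi1 rP) // (fi1 rQ) // (fi1 rZ) // (fi1 rTop) //=.
rewrite kK hE1 hP hQ => cK hU.
have ready2 : ready s2 by split; rewrite fi2 // fi1.
(* Shared end of both cases: [x] is the chosen head, and the last premise says that the pending
   merge begins with it. *)
have hleft x ia' ib' :
    (ireg s2 rU1 + K <= ir rO)%N -> (ireg s2 rU2 + K <= ir rO)%N ->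
    (forall i, (i < K)%N -> add_at rm (ireg s2 rU1) (ireg s2 rU2) i = val x i) ->
    (ia' <= size v)%N -> (ib' <= size v)%N -> (ia' + ib' = (ia + ib).+1)%N ->
    ireg s2 rP = (base + ia' * K)%N -> ireg s2 rQ = (base + ib' * K)%N ->
    merge leX (drop ia v) (map F (drop ib v)) =
      x :: merge leX (drop ia' v) (map F (drop ib' v)) ->
    wp write_sum_cmd (K * 10).+1
      (fun s' => frame (instrs merge_step_cmd) (Config l ir rr im rm) s' -> Q s') s2.
  move=> o1' o2' hx lta ltb lab eP eQ em.
  have eO : ireg s2 rO = ir rO by rewrite fi2 // fi1.
  apply: wp_write_sum => //; rewrite ?eO // rm2 => s3 [fi3 _ _ _] hO hb1 hb2 f.
  apply: (hpost s3 ia' ib' x) => //; rewrite ?fi3 //.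
    by rewrite cat_rcons -em.
  by move=> i iK; rewrite hb1 // hx.
have leK k : (k < size v)%N -> (base + k * K + K <= ir rO)%N.
  move=> lt; apply: leq_trans ho; rewrite -addnA leq_add2l -mulSnr.
  by rewrite leq_mul2r lt orbT.
rewrite leq_add2l ltn_add2l leq_pmul2r // ltn_pmul2r // in hU.
have flagE : (ia < size v)%N -> (ib < size v)%N ->
    (ireg s1 rFlag <= 1)%N = leX (nth x0 v ia) (F (nth x0 v ib)).
  move=> lta ltb; rewrite hfl /leX /lle; congr (_ <= 1)%N.
  apply: eq_lexc => i iK; rewrite /add_at ?hP ?hQ hv //.
    by rewrite hz // addr0.
  by rewrite -hF.
move: hU; case: ifP => [c|/negbT/norP[nb c]] [e1 e2 e3 e4].
  have lta : (ia < size v)%N by case/orP: c => [|/andP[]]; lia.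
  apply: (hleft (nth x0 v ia) ia.+1 ib) => //; rewrite ?e1 ?e2 //.
  - exact: leK.
  - by move=> i iK; rewrite /add_at hv // hz // addr0.
  - by rewrite e3 mulSnr addnA.
  - rewrite (drop_nth x0 lta); apply: merge_consl.
    case: (ltnP ib (size v)) => ltb; last by rewrite drop_oversize.
    by rewrite drop_nth_map //= -flagE //; move: c; rewrite leqNgt ltb lta.
rewrite -ltnNge in nb.
apply: (hleft (F (nth x0 v ib)) ia ib.+1) => //; rewrite ?e1 ?e2 //.
- exact: leK.
- by move=> i iK; rewrite /add_at hv // -hF.
- by rewrite addnS.
- by rewrite e4 mulSnr addnA.
- rewrite (drop_nth_map F nb); apply: merge_consr.
  case: (ltnP ia (size v)) => lta; last by rewrite drop_oversize.
  by rewrite (drop_nth x0 lta) /= -flagE //; move: c; rewrite lta.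
Qed.

Lemma wp_merge s v F base Q : ready s -> (0 < K)%N -> ireg s rK = K ->
  let rm := rmem s in let a := ireg s rTop in let o := ireg s rO in
  stored rm base v -> (base + size v * K <= o)%N ->
  (forall i, (i < K)%N -> rm (ireg s rZ + i)%N = 0) ->
  (ireg s rZ + K <= o)%N -> (a + K <= o)%N ->
  (forall k i, (k < size v)%N -> (i < K)%N ->
     val (F (nth x0 v k)) i = val (nth x0 v k) i + rm (a + i)%N) ->
  ireg s rE1 = (base + size v * K)%N -> ireg s rP = base -> ireg s rQ = base ->
  ireg s rStop = (o + (size v + size v) * K)%N ->
  (forall s', frame (instrs merge_cmd) s s' ->
     ireg s' rO = (o + (size v + size v) * K)%N ->
     stored (rmem s') o (merge leX v (map F v)) ->
     (forall x, (x < o)%N || (o + (size v + size v) * K <= x)%N ->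
        rmem s' x = rm x) -> Q s') ->
  wp merge_cmd ((size v + size v) * (K * 27 + 26)).+1 Q s.
Proof.
case: s => l0 ir0 rr0 im0 rm0 /= r0 K0 kK hv ho hz hzo hao hF hE1 hP hQ hstop hpost.
apply: wp_frame.
(* [d] is the prefix of the merge already written, made of [ia] entries of the list and [ib] of its
   translate; [j] entries are still missing. *)
pose I j s' := [/\ ready s', frame (instrs merge_cmd) (Config l0 ir0 rr0 im0 rm0) s' &
  exists ia ib d, [/\ (ia <= size v)%N, (ib <= size v)%N,
     size d = (ia + ib)%N, (ia + ib + j = size v + size v)%N &
   [/\ ireg s' rP = (base + ia * K)%N, ireg s' rQ = (base + ib * K)%N,
     ireg s' rO = (ir0 rO + size d * K)%N,
     d ++ merge leX (drop ia v) (map F (drop ib v)) = merge leX v (map F v) &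
     stored (rmem s') (ir0 rO) d /\
     (forall x, (x < ir0 rO)%N || (ir0 rO + (size v + size v) * K <= x)%N ->
        rmem s' x = rm0 x)]]].
apply: (wp_while (I := I) (k := size v + size v) (T := K * 27 + 24)) => //.
- by rewrite ltnS leq_mul2l -addn2 -addnA leqnn orbT.
- split=> //; first exact: frame_refl.
  by exists 0%N, 0%N, [::]; rewrite !drop0 !mul0n !addn0.
- move=> j s' [r1 f [ia [ib [d [la lb sd sj [eP eQ eO em [hd hr]]]]]]] le _.
  have [fi _ _ _] := f.
  have ee : (size v + size v <= ia + ib)%N.
    by move: le; rewrite eO (fi rStop) //= hstop leq_add2l leq_pmul2r // sd.
  have [e1 e2] : ia = size v /\ ib = size v by lia.
  move: em; rewrite e1 e2 !drop_size /= cats0 => em.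
  by apply: hpost => //; rewrite ?eO ?sd ?e1 ?e2 // -em.
- move=> s' [r1 [fi _ _ _] [ia [ib [d [_ _ sd sj [_ _ eO _ _]]]]]].
  by rewrite eO (fi rStop) //= hstop sd -sj addn0.
- move=> j s' [r1 f [ia [ib [d [la lb sd sj [eP eQ eO em [hd hr]]]]]]] _.
  have [fi _ _ _] := f.
  have below x : (x < ir0 rO)%N -> rmem s' x = rm0 x by move=> lt; rewrite hr ?lt.
  have oO : (ir0 rO <= ireg s' rO)%N by rewrite eO leq_addr.
  apply: (@wp_merge_step s' v F base ia ib d) => //.
  + by rewrite fi.
  + apply: eq_stored hv => x /andP[_ lx]; apply: below; exact: leq_trans lx ho.
  + exact: leq_trans ho oO.
  + by move=> i iK; rewrite fi // below ?hz //; apply: leq_trans hzo; rewrite ltn_add2l.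
  + by rewrite fi //; apply: leq_trans hzo oO.
  + by rewrite fi //; apply: leq_trans hao oO.
  + move=> k i kv iK; rewrite fi // below ?hF //.
    by apply: leq_trans hao; rewrite ltn_add2l.
  + by rewrite fi.
  + lia.
  move=> s2 ia' ib' x f2 la' lb' sab eP' eQ' em' eO' hb hr'; have [fi2 _ _ _] := f2.
  split.
  + by case: r1 => z o; split; rewrite fi2.
  + exact: frame_trans f f2.
  + exists ia', ib', (rcons d x); split=> //; rewrite ?size_rcons ?sd //; first lia.
    have dv : ((size d).+1 <= size v + size v)%N by lia.
    split=> //; first by rewrite eO' eO mulSnr addnA sd.
    split.
      apply: stored_rcons => [|i iK]; last by rewrite -eO hb.
      apply: eq_stored hd => y /andP[_ ly]; apply: hr'.
      by rewrite eO ly.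
    move=> y hy; rewrite hr' ?hr // eO.
    have : ((size d).+1 * K <= (size v + size v) * K)%N by rewrite leq_mul2r dv orbT.
    by rewrite mulSnr; lia.
Qed.

End Merge.

(** * Sorted lists of subset sums *)

(** After the gathering [rU2] is [j + m * n], so adding [m] gives the address of the objective entry
    of column [j]. Fresh cells are zero, so of the unit vector only the 1 at offset [m + 1 + j] is
    written. *)
Definition extend_cmd : cmd :=
  Seq (Blk [:: copy rU1 rTop; copy rU2 rJ; copy rCnt rM])
  (Seq gather_cmd
  (Seq (Blk [:: IAdd rU2 rU2 rM; RLoad 1 rU2; RStore rU1 1;
                IAdd rU1 rU1 rOne; IAdd rU1 rU1 rJ; RConst 2 1; RStore rU1 2;
                IAdd rO rTop rK; ISub rStop rE1 rS1; IAdd rStop rStop rStop;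
                IAdd rStop rO rStop; copy rP rS1; copy rQ rS1])
  (Seq merge_cmd
   (Blk [:: copy rS1 rS2; copy rE1 rE2; IAdd rS2 rTop rK; copy rE2 rO;
            copy rTop rO; IAdd rJ rJ rOne])))).

Section SubsetSums.
Variables (R : realType) (m n : nat) (rm0 : nat -> R).
Implicit Types (s : config R) (Q : config R -> Prop) (S : {set 'I_n}).

Let K := (m.+1 + n)%N.
Let Z := (m * n + m + n)%N.

(* Column [j] of the matrix with the rows of [A], the row [c] and the rows of
   the identity matrix. *)
Definition column (j : 'I_n) (i : nat) : R :=
  if (i < m)%N then rm0 (j + i * n)%N
  else if i == m then rm0 (j + m * n + m)%N else (i == m + 1 + j)%N%:R.

Definition subset_sum S (i : nat) : R := \sum_(j in S) column j i.

Notation leS := (leX subset_sum K).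

Lemma subset_sumU1 (j : 'I_n) S i : j \notin S ->
  subset_sum (j |: S) i = subset_sum S i + column j i.
Proof. by move=> jS; rewrite /subset_sum big_setU1 // addrC. Qed.

Lemma subset_sumU S1 S2 i : [disjoint S1 & S2] ->
  subset_sum (S1 :|: S2) i = subset_sum S1 i + subset_sum S2 i.
Proof. by move=> d; rewrite /subset_sum -bigU //; apply: eq_bigl => j; rewrite !inE. Qed.

(** For [b = odd j] these are the [j./2] columns of the list that column [j] is about to extend. *)
Definition parity_set (b : bool) (j : nat) : {set 'I_n} :=
  [set i : 'I_n | (i < j)%N && (odd i == b)].

(** [=i] leaves multiplicities open; the lengths, which govern the running time, are recorded
    separately in [extend_inv]. *)
Definition sorted_subsets (v : seq {set 'I_n}) (T : {set 'I_n}) : Prop :=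
  sorted leS v /\ v =i powerset T.

Lemma sorted_subsetsU1 v (T : {set 'I_n}) (j : 'I_n) : j \notin T -> sorted_subsets v T ->
  sorted_subsets (merge leS v [seq j |: B | B <- v]) (j |: T).
Proof.
move=> jT [sv mv].
have nj S : S \in v -> j \notin S.
  by rewrite mv powersetE => /subsetP ST; apply: contra jT; apply: ST.
split.
  apply: merge_sorted => //; first by move=> S1 S2; apply: lle_total.
  have allv : all [in v] v by apply/allP.
  rewrite sorted_map; apply: sub_in_sorted allv sv => S1 S2 /= S1v S2v.
  rewrite /leX /lle => h.
  rewrite (eq_lexc (fun i _ => subset_sumU1 i (nj _ S1v))
            (fun i _ => subset_sumU1 i (nj _ S2v))).
  by rewrite lexc_add2r.
move=> S; rewrite mem_merge mem_cat mv !powersetE.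
apply/orP/idP => [[ST|/mapP[S1]]|ST].
- exact: subset_trans ST (subsetUr _ _).
- by rewrite mv powersetE => ST ->; apply: setUS.
- case: (boolP (j \in S)) => jS; last first.
    left; apply/subsetP=> i iS; have := subsetP ST i iS.
    by rewrite !inE => /orP[/eqP ij|//]; rewrite -ij iS in jS.
  right; apply/mapP; exists (S :\ j); last by rewrite setD1K.
  by rewrite mv powersetE subDset.
Qed.

Lemma parity_setS_neq b (j : 'I_n) : odd j != b -> parity_set b j.+1 = parity_set b j.
Proof.
move=> jb; apply/setP=> i; rewrite !inE ltnS leq_eqVlt.
by case: eqP => [->|//]; rewrite ltnn (negPf jb).
Qed.

Lemma parity_setS_eq b (j : 'I_n) : odd j = b ->
  parity_set b j.+1 = j |: parity_set b j.
Proof.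
move=> jb; apply/setP=> i; rewrite !inE ltnS leq_eqVlt -val_eqE /=.
by case: eqP => [->|//]; rewrite jb eqxx.
Qed.

(* The lists [v1] and [v2] swap their roles after each column. *)
Definition extend_inv s0 (j : nat) s : Prop :=
  [/\ frame (instrs extend_cmd) s0 s, ready s, ireg s rJ = j, (j <= n)%N &
  exists v1 v2,
  [/\ [/\ stored set0 subset_sum K (rmem s) (ireg s rS1) v1,
       ireg s rE1 = (ireg s rS1 + size v1 * K)%N, (ireg s rE1 <= ireg s rTop)%N,
       sorted_subsets v1 (parity_set (odd j) j) & size v1 = (2 ^ j./2)%N],
    [/\ stored set0 subset_sum K (rmem s) (ireg s rS2) v2,
       ireg s rE2 = (ireg s rS2 + size v2 * K)%N, (ireg s rE2 <= ireg s rTop)%N,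
       sorted_subsets v2 (parity_set (~~ odd j) j) & size v2 = (2 ^ uphalf j)%N],
    (Z + K <= ireg s rTop)%N,
    (forall x, (x < Z + K)%N -> rmem s x = rm0 x) &
    (forall x, (ireg s rTop <= x)%N -> rmem s x = 0)]].

Hypothesis rm0Z : forall x, (Z <= x)%N -> rm0 x = 0.

Definition params s : Prop :=
  [/\ ireg s rM = m, ireg s rN = n, ireg s rK = K, ireg s rD = (m * n)%N & ireg s rZ = Z].

Lemma wp_extend s0 s (j : 'I_n) : params s0 -> extend_inv s0 j s ->
  wp extend_cmd (2 ^ uphalf n * (K * 27 + 26) + 7 * m + 25)%N (extend_inv s0 j.+1) s.
Proof.
move=> [pM pN pK pD pZ] [f r ej _ [v1 [v2 [[h1 e1 t1 s1 z1]]]]].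
move=> [h2 e2 t2 s2 z2] hZ hlow hhigh.
have K0 : (0 < K)%N by [].
apply: wp_frame.
have [fi _ _ _] := f.
rewrite -(fi rM) // in pM; rewrite -(fi rN) // in pN; rewrite -(fi rK) // in pK.
rewrite -(fi rZ) // in pZ.
move: f {fi}; case: s r ej h1 e1 t1 h2 e2 t2 hZ hlow hhigh pM pN pK pZ => l ir rr im rm /=.
case=> /= o0 o1 ej h1 e1 t1 h2 e2 t2 hZ hlow hhigh pM pN pK pZ f.
set a := ir rTop in t1 t2 hZ hhigh *.
(* The merge produces [2 ^ (j./2 + 1)] entries, and [j < n] gives [j./2 + 1 <= uphalf n]. *)
have sv : (size v1 + size v1 <= 2 ^ uphalf n)%N.
  rewrite z1 addnn -mul2n -expnS leq_exp2l //.
  by rewrite uphalf_half; have := ltn_ord j; lia.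
apply: (wp_seq (T1 := 3) (T2 := 2 ^ uphalf n * (K * 27 + 26) + 7 * m + 22)); first lia.
apply: wp_blk => //=.
apply: (wp_seq (T1 := (m * 7).+1) (T2 := 2 ^ uphalf n * (K * 27 + 26) + 21)); first lia.
apply: wp_gather => //=; rewrite ?o0 ?addn0 ?pM //.
  move=> i im'; rewrite pN ej -/a.
  have := ltn_ord j; have : (i.+1 * n <= m * n)%N by rewrite leq_mul2r im' orbT.
  by rewrite mulSn /Z in hZ *; lia.
rewrite -/a pN ej => s' [fi1 _ _ _] eU1 eU2 hcol hother.
move: fi1 eU1 eU2 hcol hother; case: s' => l' ir' rr' im' rm' /= fi1 eU1 eU2 hcol hother.
have hM : ir' rM = m by rewrite fi1.
have hOne : ir' rOne = 1%N by rewrite fi1.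
have hK : ir' rK = K by rewrite fi1.
have hZ' : ir' rZ = Z by rewrite fi1.
have hS1 : ir' rS1 = ir rS1 by rewrite fi1.
have hE1 : ir' rE1 = ir rE1 by rewrite fi1.
have hS2 : ir' rS2 = ir rS2 by rewrite fi1.
have hE2 : ir' rE2 = ir rE2 by rewrite fi1.
have hTop : ir' rTop = a by rewrite fi1.
have hJ : ir' rJ = j by rewrite fi1.
have h0 : ir' rZero = 0%N by rewrite fi1.
have jn := ltn_ord j.
apply: (wp_seq (T1 := 13) (T2 := 2 ^ uphalf n * (K * 27 + 26) + 8)); first lia.
apply: wp_blk => //=.
apply: (wp_seq (T1 := 2 ^ uphalf n * (K * 27 + 26) + 1) (T2 := 7)); first lia.
rewrite eU1 eU2 hM hOne hK hJ hTop hE1 hS1 h0 !addn0 e1.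
(* The memory when the merge starts: the objective entry and the single 1 complete the gathered
   column. *)
pose rm2 : nat -> R := [eta [eta rm' with (a + m)%N |-> rm' (j + m * n + m)%N]
  with (a + m + 1 + j)%N |-> 1]; rewrite -/rm2.
have low x : (x < a)%N -> rm2 x = rm x.
  by move=> xa; rewrite /rm2 /= !ifF ?hother ?xa //; lia.
have high x : (a + K <= x)%N -> rm2 x = 0.
  by move=> xa; rewrite /rm2 /= !ifF ?hother ?hhigh //; rewrite /K in xa *; lia.
have hcol' i : (i < K)%N -> rm2 (a + i)%N = column j i.
  move=> iK; rewrite /rm2 /column /=; case: (ltngtP i m) => im1.
  - rewrite !ifF ?hcol ?hlow //; try lia.
    have : (i.+1 * n <= m * n)%N by rewrite leq_mul2r im1 orbT.
    by rewrite mulSn /Z; lia.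
  - rewrite (_ : (a + i == a + m + 1 + j) = (i == m + 1 + j))%N; last by lia.
    case: ifP => // ne; rewrite ifF; last by lia.
    by rewrite hother ?hhigh //; lia.
  - rewrite im1 ifF ?eqxx; last by lia.
    by rewrite hother ?hlow //; rewrite /Z /K in hZ *; lia.
apply: (@wp_conseq _ _ ((size v1 + size v1) * (K * 27 + 26)).+1 _ _ _ _ _ (fun _ q => q)).
  by rewrite addn1 ltnS leq_mul2r sv orbT.
apply: (wp_merge (x0 := set0) (val := subset_sum) (K := K) (v := v1)
  (F := fun B => j |: B) (base := ir rS1)) => //=; rewrite ?hTop ?hE1 ?hZ' ?hS1 ?addn0 //.
- apply: eq_stored h1 => x /andP[_ xl]; apply: low.
  by apply: leq_trans xl _; rewrite -e1.
- by rewrite -e1; apply: leq_trans t1 (leq_addr _ _).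
- move=> i iK; rewrite low ?hlow ?rm0Z ?leq_addr // ?ltn_add2l //.
  by apply: leq_trans hZ; rewrite ltn_add2l.
- by apply: leq_trans hZ (leq_addr _ _).
- move=> k i kv iK; rewrite hcol' // subset_sumU1 //.
  have := mem_nth set0 kv; rewrite s1.2 powersetE => /subsetP sub.
  by apply/negP=> /sub; rewrite inE ltnn.
- by rewrite addKn mulnDl.
case=> l3 ir3 rr3 im3 rm3 /= [/= fi3 _ _ _] eO3 hst hoth; apply: wp_blk => //= f3.
have g0 : ir3 rZero = 0%N by rewrite fi3.
have gOne : ir3 rOne = 1%N by rewrite fi3.
have gJ : ir3 rJ = j by rewrite fi3.
have gS2 : ir3 rS2 = ir rS2 by rewrite fi3.
have gE2 : ir3 rE2 = ir rE2 by rewrite fi3.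
have gTop : ir3 rTop = a by rewrite fi3.
have gK : ir3 rK = K by rewrite fi3.
set top := (a + K + _)%N in eO3 hoth.
have low3 x : (x < a)%N -> rm3 x = rm x.
  by move=> xa; rewrite hoth ?low //; apply/orP; left; lia.
split => //=.
- exact: frame_trans f f3.
- by rewrite gJ gOne addn1.
rewrite g0 gS2 gE2 gTop gK !addn0 eO3.
have aK : (a + K <= top)%N by rewrite leq_addr.
exists v2, (merge leS v1 [seq j |: B | B <- v1]); split.
- split=> //.
  + by apply: eq_stored h2 => x /andP[_ xl]; apply: low3; lia.
  + by lia.
  + by rewrite parity_setS_neq // -addbT -negb_eqb; case: odd.
- rewrite negbK size_merge size_cat size_map; split=> //.
  + by rewrite parity_setS_eq //; apply: sorted_subsetsU1; rewrite // inE ltnn.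
  + by rewrite z1 addnn -mul2n -expnS.
- by lia.
- by move=> x xZ; rewrite low3 ?hlow //; lia.
- by move=> x xt; rewrite hoth ?high ?xt ?orbT //; lia.
Qed.

End SubsetSums.

(** * The search for the best pair *)

(** At the first hit the best value is initialized with the current cost, so the test that follows
    succeeds and no infinite start value is needed. Adding real register 4, which is 0, acts as a
    copy. *)
Definition record_cmd : cmd :=
  Seq (Blk [:: IAdd rU1 rP rM; RLoad 1 rU1; IAdd rU2 rT rM; RLoad 2 rU2;
               RAdd 1 1 2])
  (Seq (IfI rFound rZero (Blk [:: RAdd 0 1 4]) (Blk [::]))
  (IfR 1 0
    (Blk [:: RAdd 0 1 4; IConst rFound 1; copy rBP rP; copy rBQ rT])
    (Blk [::]))).

(** [rQ] is the end of the unexplored part of the second list, so the candidate [rT] lies one entry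
    below. When nothing is left there, [rP] is moved to [rE1], because the loop tests only the first
    pointer. *)
Definition match_step_cmd : cmd :=
  Seq (Blk [:: ISub rT rQ rK; copy rU1 rP; copy rU2 rT; copy rU3 rD;
               copy rU4 rZ; copy rCnt rM])
  (Seq compare_cmd
  (IfI rFlag rZero (Blk [:: IAdd rP rP rK])
  (Seq (IfI rFlag rOne record_cmd (Blk [::]))
  (Seq (Blk [:: copy rQ rT]) (IfI rQ rS2 (Blk [:: copy rP rE1]) (Blk [::])))))).

Definition match_cmd : cmd := While rP rE1 match_step_cmd.

Section Match.
Variables (R : realType) (m l : nat) (N1 N2 : nat) (f1 f2 : nat -> nat -> R)
  (beta : nat -> R).
Implicit Types (s : config R) (Q : config R -> Prop).
Let K := (m.+1 + l)%N.

Hypothesis mono1 : forall i i', (i <= i')%N -> (i' < N1)%N -> lle K (f1 i) (f1 i').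
Hypothesis mono2 : forall j j', (j <= j')%N -> (j' < N2)%N -> lle K (f2 j) (f2 j').

Definition hit (i j : nat) : Prop :=
  forall r, (r < m)%N -> f1 i r + f2 j r = beta r.

Definition cost (i j : nat) : R := f1 i m + f2 j m.

Definition key_cmp (i j : nat) : nat := lexc m (fun r => f1 i r + f2 j r) beta.

Lemma hitE i j : key_cmp i j = 1%N <-> hit i j.
Proof. exact: lexc_eq1. Qed.

(** A key sum that is too small at [j] is too small at all earlier entries; this permits the first
    pointer to advance. *)
Lemma key_cmp_lt i j j' : key_cmp i j = 0%N -> (j' <= j)%N -> (j < N2)%N ->
  ~ hit i j'.
Proof.
move=> k0 jj jN /hitE k1.
have le : lle m (fun r => f1 i r + f2 j' r) (fun r => f1 i r + f2 j r).
  rewrite /lle (@eq_lexc _ _ _ (fun r => f2 j' r + f1 i r) _ (fun r => f2 j r + f1 i r));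
    try by move=> *; rewrite addrC.
  rewrite lexc_add2r; apply: (@lle_prefix _ m l.+1).
  by have := mono2 jj jN; rewrite /K addSnnS.
have := lexc_trans le (_ : lle m _ beta); rewrite /lle -/(key_cmp i j) k0 => /(_ isT).
by rewrite -/(key_cmp i j') k1 minn0.
Qed.

(** The mirror image, which permits the second pointer to descend. *)
Lemma key_cmp_gt i i' j : key_cmp i j = 2%N -> (i <= i')%N -> (i' < N1)%N ->
  ~ hit i' j.
Proof.
move=> k2 ii iN /hitE k1.
have le : lle m (fun r => f1 i r + f2 j r) (fun r => f1 i' r + f2 j r).
  rewrite /lle lexc_add2r; apply: (@lle_prefix _ m l.+1).
  by have := mono1 ii iN; rewrite /K addSnnS.
have := lexc_trans le (_ : lle m _ beta); rewrite /lle -/(key_cmp i' j) k1 => /(_ isT).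
rewrite -/(key_cmp i j) k2; move: le; rewrite /lle; lia.
Qed.

(** Cancelling the common summand [f2 j] shows that the two entries of the first list have equal
    keys, so [lle_next] compares their costs. *)
Lemma hit_cost_le i i' j : hit i j -> hit i' j -> (i <= i')%N -> (i' < N1)%N ->
  cost i j <= cost i' j.
Proof.
move=> h h' ii iN; rewrite /cost lerD2r; apply: lle_next (mono1 ii iN) _ => r rm.
by apply: (addIr (f2 j r)); rewrite h ?h'.
Qed.

(** [D] marks the pairs already settled. By the first clause no settled hit is cheaper than the
    record, by the second the record is attained at the remembered addresses. Once [D] is
    everything, this is optimality. *)
Definition best_inv (S1 S2 : nat) (D : nat -> nat -> bool) s : Prop :=
  (forall i j, (i < N1)%N -> (j < N2)%N -> D i j -> hit i j ->
     ireg s rFound = 1%N /\ rreg s 0%N <= cost i j) /\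
  (ireg s rFound = 0%N \/
   ireg s rFound = 1%N /\ exists i j, [/\ (i < N1)%N, (j < N2)%N, hit i j,
     rreg s 0%N = cost i j &
     ireg s rBP = (S1 + i * K)%N /\ ireg s rBQ = (S2 + j * K)%N]).

Lemma wp_record s S1 S2 D i j Q : ready s -> ireg s rM = m -> rreg s 4%N = 0 ->
  ireg s rP = (S1 + i * K)%N -> ireg s rT = (S2 + j * K)%N ->
  (i < N1)%N -> (j < N2)%N ->
  rmem s (S1 + i * K + m)%N = f1 i m -> rmem s (S2 + j * K + m)%N = f2 j m ->
  hit i j -> best_inv S1 S2 D s ->
  (forall s', frame (instrs record_cmd) s s' ->
     best_inv S1 S2 (fun i' j' => D i' j' || (i <= i')%N && (j' == j)) s' -> Q s') ->
  wp record_cmd 20 Q s.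
Proof.
case: s => l0 ir rr im rm [/= r0 r1] rM0 rr4 eP eT iN jN m1 m2 hij [/= hd fd] hQ.
apply: wp_frame.
apply: (wp_seq (T1 := 5) (T2 := 15)) => //; apply: wp_blk => //=.
rewrite !rM0 eP eT m1 m2 -/(cost i j).
(* The record is overwritten; the last premise says that an earlier one, if any, was at least as
   expensive. *)
have new rr1 ir1 im1 l1 rm1 :
    rr1 0%N = cost i j -> ir1 rFound = 1%N ->
    ir1 rBP = (S1 + i * K)%N -> ir1 rBQ = (S2 + j * K)%N ->
    (ir rFound = 1%N -> cost i j <= rr 0%N) ->
    best_inv S1 S2 (fun i' j' => D i' j' || (i <= i')%N && (j' == j))
      (Config l1 ir1 rr1 im1 rm1).
  move=> e0 ef eb1 eb2 imp; split=> /=; last by right; split=> //; exists i, j.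
  move=> i' j' iN' jN' /orP[dij|/andP[ii /eqP ->]] h'; rewrite ef e0; split=> //.
    by have [f1' le] := hd _ _ iN' jN' dij h'; apply: le_trans (imp f1') le.
  exact: hit_cost_le.
apply: (wp_seq (T1 := 3) (T2 := 12)) => //.
apply: (wp_ifI (T := 1)) => //=; rewrite r0 => h; apply: wp_blk => //=;
  apply: (wp_ifR (T := 4)) => //=; rewrite ?rr4 ?addr0 ?ltxx // => h';
  apply: wp_blk => //= f; apply: hQ => //.
- apply: new => //=; rewrite ?rr4 ?addr0 ?r0 ?addn0 ?eP ?eT //.
  by move=> f1'; rewrite f1' in h.
- by apply: new => //=; rewrite ?rr4 ?addr0 ?r0 ?addn0 ?eP ?eT.
- case: fd => [f0|[f1' fd]]; first by rewrite f0 in h.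
  split=> /=; last by right.
  move=> i' j' iN' jN' /orP[dij|/andP[ii /eqP ->]] h2; first exact: hd.
  by split=> //; apply: le_trans (ltW h') _; apply: hit_cost_le.
Qed.

(** The unsettled pairs form the rectangle [ia <= i], [j < jb]. It keeps some [j] as long as the
    loop runs, so that the candidate [jb - 1] exists. *)
Definition match_inv s0 (S1 S2 ia jb : nat) s : Prop :=
  [/\ frame (instrs match_cmd) s0 s, ready s, (ia <= N1)%N /\ (jb <= N2)%N,
     ((ia < N1)%N -> (0 < jb)%N) &
     [/\ ireg s rP = (S1 + ia * K)%N, ireg s rQ = (S2 + jb * K)%N &
     best_inv S1 S2 (fun i j => (i < ia)%N || (jb <= j)%N) s]].

(** Progress is growth of [ia - jb], compared in additive form because subtraction of naturals
    truncates. *)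
Lemma wp_match_step s0 s S1 S2 ia jb :
  ireg s0 rM = m -> ireg s0 rK = K -> rreg s0 4%N = 0 ->
  ireg s0 rE1 = (S1 + N1 * K)%N -> ireg s0 rS2 = S2 ->
  (forall i r, (i < N1)%N -> (r < K)%N -> rmem s0 (S1 + i * K + r)%N = f1 i r) ->
  (forall j r, (j < N2)%N -> (r < K)%N -> rmem s0 (S2 + j * K + r)%N = f2 j r) ->
  (forall r, (r < m)%N -> add_at (rmem s0) (ireg s0 rD) (ireg s0 rZ) r = beta r) ->
  match_inv s0 S1 S2 ia jb s -> (ia < N1)%N ->
  wp match_step_cmd (m * 17 + 40) (fun s' => exists ia' jb',
    match_inv s0 S1 S2 ia' jb' s' /\ (ia + jb' < ia' + jb)%N) s.
Proof.
move=> eM eK e4 eE1 eS2 h1 h2 hb [f r [lea ljb] pos [eP eQ bi]] iN.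
apply: wp_frame; have [fi fr _ [//|fm]] := f; rewrite -fm in h1 h2 hb.
rewrite -(fi rM) // in eM; rewrite -(fi rK) // in eK; rewrite -(fr 4) // in e4.
rewrite -(fi rE1) // in eE1; rewrite -(fi rS2) // in eS2.
rewrite -(fi rD) // -(fi rZ) // in hb.
move: {fi fr fm} f r eM eK e4 eE1 eS2 h1 h2 hb eP eQ bi.
case: s => l0 ir rr im rm f [/= r0 r1] eM eK e4 eE1 eS2 h1 h2 hb eP eQ bi.
case: jb => [|jb] in ljb pos eQ bi *; first by have := pos iN.
have K0 : (0 < K)%N by [].
have mS a i : (a + i.+1 * K = a + i * K + K)%N by rewrite mulSnr addnA.
apply: (wp_seq (T1 := 6) (T2 := m * 17 + 34)); first lia.
apply: wp_blk => //=.
apply: (wp_seq (T1 := m * 17 + 2) (T2 := 32)); first lia.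
apply: wp_compare => //=; first by rewrite r0 addn0.
rewrite !r0 !addn0 eP eQ eK mulSnr addnA addnK.
case=> l1 ir1 rr1 im1 rm1 /= [/= fi1 fr1 [//|/= _] [//|/= erm]] hfl; subst rm1.
have {hfl} hfl : ir1 rFlag = key_cmp ia jb.
  rewrite hfl; apply: eq_lexc => q qm; last exact: hb.
  by rewrite /add_at h1 ?h2 // /K; lia.
have rr4 : rr1 4%N = 0 by rewrite fr1.
have gT : ir1 rT = (S2 + jb * K)%N by rewrite fi1.
have gP : ir1 rP = (S1 + ia * K)%N by rewrite fi1.
have gM : ir1 rM = m by rewrite fi1.
have gK : ir1 rK = K by rewrite fi1.
have g0 : ir1 rZero = 0%N by rewrite fi1.
have g1 : ir1 rOne = 1%N by rewrite fi1.
have gE1 : ir1 rE1 = (S1 + N1 * K)%N by rewrite fi1.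
have gS2 : ir1 rS2 = S2 by rewrite fi1.
have gQ : ir1 rQ = (S2 + jb * K + K)%N by rewrite fi1 //= eQ mulSnr addnA.
have bi1 : best_inv S1 S2 (fun i j => (i < ia)%N || (jb < j)%N) (Config l1 ir1 rr1 im1 rm).
  by case: bi => /= b1 b2; rewrite /best_inv /= !fi1 // !fr1.
have fT := frame_trans f.
clear fi1 fr1 bi.
apply: (wp_ifI (T := 30)) => //=; rewrite g0 hfl => cmp.
  apply: wp_blk => //= f'; exists ia.+1, jb.+1; split; last by rewrite addSn.
  split=> //=; first exact: fT f'.
  split; rewrite ?gP ?gK ?gQ ?mS //; case: bi1 => /= b1 b2; split=> //= i j iN' jN'.
  (* In row [ia] the entries above [jb] are settled already; from [jb] downwards the key sum is too
     small. *)
  case: (ltnP jb j) => [lt _|le]; first by apply: b1 => //; rewrite lt orbT.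
  rewrite orbF ltnS leq_eqVlt => /orP[/eqP ->|lt]; last by apply: b1; rewrite ?lt.
  by move=> /(key_cmp_lt _ le ljb) []; apply/eqP; rewrite -leqn0.
(* If the key sum is not too small, [jb] gets settled for all [i >= ia]: after a hit by the record,
   otherwise because the key sums are too large. *)
pose D i j := ((i < ia)%N || (jb < j)%N) || (ia <= i)%N && (j == jb).
apply: (wp_seq (T1 := 22) (T2 := 8)) => //.
have fin s' : frame (instrs (IfI rFlag rOne record_cmd (Blk [::])))
    (Config l1 ir1 rr1 im1 rm) s' -> best_inv S1 S2 D s' ->
  wp (Seq (Blk [:: copy rQ rT]) (IfI rQ rS2 (Blk [:: copy rP rE1]) (Blk [::]))) 8
   (fun s'0 => frame (instrs match_step_cmd) (Config l0 ir rr im rm) s'0 ->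
     exists ia' jb', match_inv s0 S1 S2 ia' jb' s'0 /\ (ia + jb' < ia' + jb.+1)%N) s'.
  case: s' => l2 ir2 rr2 im2 rm2 [/= fi2 _ _ _] bD.
  have eD : best_inv S1 S2 (fun i j => (i < ia)%N || (jb <= j)%N) (Config l2 ir2 rr2 im2 rm2).
    case: bD => /= b1 b2; split=> // i j iN' jN' h; apply: b1 => //; rewrite /D.
    by move: h; case: ltnP => //= _; rewrite leq_eqVlt eq_sym orbC.
  apply: (wp_seq (T1 := 1) (T2 := 7)) => //; apply: wp_blk => //=.
  apply: (wp_ifI (T := 4)) => //=; rewrite !fi2 // gT gS2 g0 addn0 => hj;
    apply: wp_blk => //= f'.
    (* The second list is exhausted, so jumping to [N1] skips only settled pairs. *)
    have {hj} j0 : jb = 0%N.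
      move: hj; rewrite -[X in (_ <= X)%N]addn0 leq_add2l leqn0 muln_eq0.
      by move=> /orP[/eqP|/eqP].
    exists N1, jb; split; last lia.
    split=> //=; first exact: fT f'.
    - by split; rewrite /= fi2.
    - by rewrite j0; split.
    - by rewrite ltnn.
    split; rewrite ?fi2 ?g0 ?addn0 ?gE1 //; case: eD => b1 b2; split=> // i j iN' jN' _.
    by apply: b1; rewrite // j0 orbT.
  exists ia, jb; split; last by rewrite addnS.
  split=> //=; first exact: fT f'.
  - by split; rewrite /= fi2.
  - by split=> //; apply: ltnW.
  - by move=> _; rewrite lt0n; apply: contraTneq hj => ->; rewrite mul0n addn0 ltnn.
  by split; rewrite ?fi2 ?g0 ?gP ?addn0.
apply: (wp_ifI (T := 20)) => //=; rewrite g1 hfl => cmp1.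
  have ht : hit ia jb by apply/hitE; lia.
  apply: (wp_record (S1 := S1) (S2 := S2) (i := ia) (j := jb)) bi1 _ => //=.
  - by rewrite h1 // /K; lia.
  - by rewrite h2 // /K; lia.
apply: wp_blk => //; apply: fin; first exact: frame_refl.
case: bi1 => /= b1 b2; split=> // i j iN' jN' /orP[|/andP[ii /eqP ->]]; first exact: b1.
(* Symmetry supplies the bound 2 on the outcome of a comparison, so exceeding 1 means being 2. *)
move=> /(key_cmp_gt _ ii iN') []; move: (lexc_sym m beta (fun r => f1 ia r + f2 jb r)).
by rewrite -/(key_cmp ia jb); lia.
Qed.

Lemma wp_match s0 S1 S2 Q : ready s0 -> (0 < N2)%N ->
  ireg s0 rM = m -> ireg s0 rK = K -> rreg s0 4%N = 0 -> ireg s0 rFound = 0%N ->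
  ireg s0 rE1 = (S1 + N1 * K)%N -> ireg s0 rS2 = S2 ->
  ireg s0 rP = S1 -> ireg s0 rQ = (S2 + N2 * K)%N ->
  (forall i r, (i < N1)%N -> (r < K)%N -> rmem s0 (S1 + i * K + r)%N = f1 i r) ->
  (forall j r, (j < N2)%N -> (r < K)%N -> rmem s0 (S2 + j * K + r)%N = f2 j r) ->
  (forall r, (r < m)%N -> add_at (rmem s0) (ireg s0 rD) (ireg s0 rZ) r = beta r) ->
  (forall s, frame (instrs match_cmd) s0 s ->
     best_inv S1 S2 (fun _ _ => true) s -> Q s) ->
  wp match_cmd ((N1 + N2) * (m * 17 + 42)).+1 Q s0.
Proof.
move=> r0 N20 eM eK e4 ef eE1 eS2 eP eQ h1 h2 hb hQ.
(* The potential [N1 - ia + jb] starts at [N1 + N2] and falls in every round. *)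
pose I k s := exists ia jb, match_inv s0 S1 S2 ia jb s /\ (N1 + jb <= ia + k)%N.
apply: (wp_while (I := I) (k := N1 + N2) (T := m * 17 + 40)).
- by rewrite ltnS leq_mul2l -addn2 -addnA leqnn orbT.
- exists 0%N, N2; split=> //; split=> //; first exact: frame_refl.
  split; rewrite ?addn0 //; split; last by left.
  by move=> i j _ jN; rewrite [(N2 <= j)%N]leqNgt jN.
- move=> k s [ia [jb [[f _ [lea _] _ [eP' _ [b1 b2]]] _]]].
  have [fi _ _ _] := f.
  rewrite eP' (fi rE1) // eE1 leq_add2l leq_pmul2r // => le.
  apply: hQ => //; split=> // i j iN jN _; apply: b1 => //.
  by rewrite (leq_trans iN le).
- move=> s [ia [jb [[[fi _ _ _] _ _ _ [eP' _ _]] le]]].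
  by rewrite eP' (fi rE1) // eE1 leq_add2l leq_pmul2r //; lia.
- move=> k s [ia [jb [inv le]]].
  have [[fi _ _ _] _ _ _ [eP' _ _]] := inv.
  rewrite eP' (fi rE1) // eE1 ltn_add2l ltn_pmul2r // => lt.
  apply: wp_conseq (wp_match_step eM eK e4 eE1 eS2 h1 h2 hb inv lt) => // s'.
  by case=> ia' [jb' [inv' lt']]; exists ia', jb'; split=> //; lia.
Qed.

End Match.

(** Without conversion from real to integer, a bit is read off by a test against 0; the integer
    memory is zero so far, so only the ones are written. Register 0 holds [m] until the addresses
    are computed and receives the verdict last. *)
Definition output_cmd : cmd :=
  Seq (Blk [:: copy rJ rZero; IAdd rU1 rBP rM; IAdd rU1 rU1 rOne;
               IAdd rU2 rBQ rM; IAdd rU2 rU2 rOne])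
  (Seq (While rJ rN
    (Seq (Blk [:: RLoad 1 rU1; RLoad 2 rU2; RAdd 1 1 2])
    (Seq (IfR 1 4 (Blk [::]) (Blk [:: IStore rJ rOne]))
    (Blk [:: IAdd rU1 rU1 rOne; IAdd rU2 rU2 rOne; IAdd rJ rJ rOne]))))
  (Blk [:: copy rM rFound])).

Section Output.
Variable R : realType.
Implicit Types (s : config R) (Q : config R -> Prop).

Lemma wp_output s n Q : ready s -> ireg s rN = n -> rreg s 4%N = 0 ->
  (forall j, imem s j = 0%N) ->
  (forall s', frame (instrs output_cmd) s s' -> ireg s' 0%N = ireg s rFound ->
     (forall j, (j < n)%N -> imem s' j =
        (0 < add_at (rmem s) (ireg s rBP + ireg s rM + 1)
                             (ireg s rBQ + ireg s rM + 1) j)%R :> nat) ->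
     Q s') ->
  wp output_cmd (n * 12 + 7) Q s.
Proof.
case: s => l0 ir0 rr0 im0 rm0 [/= r0 r1] eN rr4 im00 hQ; apply: wp_frame.
apply: (wp_seq (T1 := 5) (T2 := n * 12 + 2)); first lia.
apply: wp_blk => //=; rewrite r1 r0 addn0.
apply: (wp_seq (T1 := (n * 12).+1) (T2 := 1)); first lia.
set a := (ir0 22 + _ + 1)%N in hQ *; set a' := (ir0 23 + _ + 1)%N in hQ *.
pose I k s' := [/\ [/\ ready s', ireg s' rN = n, ireg s' rFound = ir0 rFound
    & rreg s' 4%N = 0],
  (ireg s' rJ + k = n)%N,
  ireg s' rU1 = (a + ireg s' rJ)%N /\ ireg s' rU2 = (a' + ireg s' rJ)%N,
  rmem s' = rm0 &
  forall j, imem s' j = ((j < ireg s' rJ)%N && (0 < add_at rm0 a a' j)%R)].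
apply: (wp_while (I := I) (k := n) (T := 10)) => //.
- split=> //=; first by split; rewrite ?addn0.
- move=> k [l ir rr im rm] [[/= [e0 _] e1 e2 _] e3 _ _ e5]; rewrite e1 => le.
  apply: wp_blk => //= f; apply: hQ => //=; first by rewrite (_ : ir rZero = 0%N) ?addn0.
  by move=> j jn; rewrite e5 (leq_trans jn le).
- by move=> s' [[_ -> _ _] <- _ _ _]; rewrite addn0.
- move=> k [l ir rr im rm] [[/= [e0 e0'] e1 e2 e4] e3 [eu eu'] -> e5] _.
  rewrite /= in e0 e0'.
  apply: (wp_seq (T1 := 3) (T2 := 7)) => //; apply: wp_blk => //=.
  rewrite eu eu' -/(add_at rm0 a a' (ir rJ)).
  have same j : j <> ir rJ -> (j < ir rJ + 1)%N = (j < ir rJ)%N by lia.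
  apply: (wp_seq (T1 := 4) (T2 := 3)) => //.
  apply: (wp_ifR (T := 1)) => //=; rewrite e4 => h; apply: wp_blk => //=;
    apply: wp_blk => //=; split=> //=; rewrite ?e0' -?addnA //; try lia.
    move=> j; rewrite e5; case: (j =P ir rJ) => [->|/same ->] //.
    by rewrite ltnn addn1 ltnSn ltNge h.
  move=> j; case: (j =P ir rJ) => [->|/same ->] //.
  by rewrite addn1 ltnSn h.
Qed.

End Output.

(** * The solver *)

(** The product [m * n] takes [m] additions, as the machine cannot multiply integers. Both lists
    begin as the same zero entry at [rZ]. *)
Definition setup_cmd : cmd :=
  Seq (Blk [:: IConst rOne 1; IAdd rK rM rN; IAdd rK rK rOne; copy rCnt rM])
  (Seq (While rZero rCnt (Blk [:: IAdd rD rD rN; ISub rCnt rCnt rOne]))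
  (Blk [:: IAdd rZ rD rM; IAdd rZ rZ rN; copy rS1 rZ; copy rS2 rZ;
           IAdd rTop rZ rK; copy rE1 rTop; copy rE2 rTop])).

Definition solve_cmd : cmd :=
  Seq setup_cmd
  (Seq (While rJ rN extend_cmd)
  (Seq (Blk [:: copy rP rS1; copy rQ rE2])
  (Seq match_cmd output_cmd))).

Section Solve.
Variables (R : realType) (m n : nat) (rm0 : nat -> R).
Implicit Types (s : config R) (Q : config R -> Prop) (S : {set 'I_n}).

Let K := (m.+1 + n)%N.
Let Z := (m * n + m + n)%N.

Hypothesis rm0Z : forall x, (Z <= x)%N -> rm0 x = 0.

Notation sum S := (subset_sum m rm0 S).

Let s0 : config R := Config 0%N (nth 0%N [:: m; n]) (fun=> 0) (fun=> 0%N) rm0.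

Lemma wp_setup Q :
  (forall s, frame (instrs setup_cmd) s0 s -> ready s -> params m n s ->
     extend_inv m n rm0 s 0 s -> Q s) ->
  wp setup_cmd (m * 4 + 12) Q s0.
Proof.
move=> hQ; apply: wp_frame.
apply: (wp_seq (T1 := 4) (T2 := m * 4 + 8)); first lia.
apply: wp_blk => //=.
apply: (wp_seq (T1 := (m * 4).+1) (T2 := 7)); first lia.
pose I k s := [/\ ready s, ireg s rM = m /\ ireg s rN = n, ireg s rK = (m + n + 1)%N,
  ireg s rJ = 0%N &
  [/\ (k <= m)%N, ireg s rCnt = k, ireg s rD = ((m - k) * n)%N & rmem s = rm0]].
apply: (wp_while (I := I) (k := m) (T := 2)) => //.
- by split=> //=; split=> //=; rewrite ?addn0 // subnn.
- move=> k [l ir rr im rm] [[/= r0 r1] [e1 e2] e3 e4 [_ ek ed ->]].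
  rewrite ek r0 leqn0 => /eqP k0; rewrite k0 subn0 in ed.
  apply: wp_blk => //= f; apply: hQ => //=.
    by split=> //=; rewrite ?e1 ?e2 ?e3 ?ed //; rewrite /K; lia.
  split=> //=; first exact: frame_refl.
  rewrite r0 e1 e2 e3 ed !addn0 -/Z.
  have KE : (m + n + 1)%N = K by rewrite /K; lia.
  rewrite KE; have K0 : (0 < K)%N by [].
  have sub0 b : sorted_subsets m rm0 [:: set0] (parity_set n b 0).
    split=> // S; rewrite powersetE mem_seq1 -subset0.
    by congr (_ \subset _); apply/setP=> i; rewrite !inE.
  have st : stored set0 (fun S => sum S) K rm0 Z [:: set0].
    by case=> // i _ _; rewrite rm0Z /subset_sum ?big_set0 // /=; lia.
  exists [:: set0], [:: set0]; split; rewrite ?mul1n //.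
  by move=> x xz; apply: rm0Z; lia.
- by move=> s [[-> _] _ _ _ [_ -> _ _]].
- move=> k [l ir rr im rm] [[/= r0 r1] [e1 e2] e3 e4 [lk ek ed ->]] _.
  apply: wp_blk => //=; split=> //=; split=> //=; rewrite ?ek ?ed ?r1 ?e2; try lia.
  by rewrite (_ : (m - k = (m - k.+1).+1)%N) ?mulSnr //; lia.
Qed.

Lemma wp_extend_loop s Q : params m n s -> extend_inv m n rm0 s 0 s ->
  (forall s', extend_inv m n rm0 s n s' -> Q s') ->
  wp (While rJ rN extend_cmd)
    (n * (2 ^ uphalf n * (K * 27 + 26) + 7 * m + 27)).+1 Q s.
Proof.
move=> ps inv hQ.
have eN s' j : extend_inv m n rm0 s j s' -> ireg s' rN = n.
  by case=> -[fi _ _ _] _ _ _ _; rewrite fi //; case: ps.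
pose I k s' := (k <= n)%N /\ extend_inv m n rm0 s (n - k) s'.
apply: (wp_while (I := I) (k := n) (T := 2 ^ uphalf n * (K * 27 + 26) + 7 * m + 25)).
- by rewrite ltnS leq_mul2l -addn2 -addnA leqnn orbT.
- by split=> //; rewrite subnn.
- move=> k s' [kn inv']; rewrite (eN _ _ inv'); case: (inv') => _ _ -> _ _ le.
  have e : (n - k)%N = n by lia.
  by apply: hQ; rewrite e in inv'.
- by move=> s' [_ inv']; rewrite (eN _ _ inv'); case: (inv') => _ _ -> _ _; rewrite subn0.
- move=> k s' [kn inv'] _; have lt : (n - k.+1 < n)%N by lia.
  have := wp_extend rm0Z (j := Ordinal lt) ps inv'.
  apply: wp_conseq => // s2 /=; rewrite (_ : (n - k.+1).+1 = n - k)%N; last by lia.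
  by move=> h; split=> //; apply: ltnW.
Qed.

Definition solution S : Prop :=
  forall r, (r < m)%N -> sum S r = rm0 (m * n + r)%N.

Definition solve_time : nat :=
  (m * 4 + 12 + ((n * (2 ^ uphalf n * (K * 27 + 26) + 7 * m + 27)).+1
   + (2 + (((2 ^ n./2 + 2 ^ uphalf n) * (m * 17 + 42)).+1 + (n * 12 + 7)))))%N.

Definition solved s : Prop :=
  (ireg s 0%N = 1%N /\ exists S, [/\ solution S, rreg s 0%N = sum S m,
     (forall j : 'I_n, imem s j = (j \in S)) &
     forall S', solution S' -> sum S m <= sum S' m]) \/
  (ireg s 0%N = 0%N /\ forall S, ~ solution S).

(** The identity rows turn these coordinates into the indicator vector, from which the output is
    read. *)
Lemma subset_sum_bit S (j : 'I_n) : sum S (m + 1 + j)%N = (j \in S)%:R.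
Proof.
rewrite /subset_sum (eq_bigr (fun k : 'I_n => (k == j)%:R)); last first.
  move=> k _; rewrite /column ifF; last by lia.
  by rewrite ifF ?eqn_add2l 1?eq_sym //; lia.
rewrite big_mkcond (bigD1 j) //= big1 ?addr0 ?eqxx; first by case: ifP.
by move=> k /negPf ->; case: ifP.
Qed.

Lemma parity_sets_disjoint b j : [disjoint parity_set n b j & parity_set n (~~ b) j].
Proof.
rewrite -setI_eq0; apply/eqP/setP=> i; rewrite !inE.
by case: (odd i); case: b; rewrite ?andbF.
Qed.

Lemma parity_setsU b : parity_set n b n :|: parity_set n (~~ b) n = [set: 'I_n].
Proof. by apply/setP=> i; rewrite !inE ltn_ord; case: (odd i); case: b. Qed.

Lemma sorted_subsets_mono v (T : {set 'I_n}) i i' : sorted_subsets m rm0 v T ->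
  (i <= i')%N -> (i' < size v)%N ->
  lle K (sum (nth set0 v i)) (sum (nth set0 v i')).
Proof.
move=> [so _] ii iv; apply: (sorted_leq_nth (leT := leX (fun S => sum S) K)) => //.
- by move=> x y z; apply: lle_trans.
- by move=> x; have := lle_total K (sum x) (sum x); rewrite orbb.
- by rewrite inE (leq_ltn_trans ii).
Qed.

Lemma wp_solve Q : (forall s, solved s -> Q s) -> wp solve_cmd solve_time Q s0.
Proof.
move=> hQ; rewrite /solve_time; apply: wp_seq (leqnn _) _.
apply: wp_setup => s1 fs1 _ ps inv0.
apply: wp_seq (leqnn _) _; apply: wp_extend_loop => // s2.
case=> fs2 r2 _ _ [v1 [v2 [[h1 e1 _ so1 z1] [h2 e2 _ so2 z2] hZ low high]]].
have [fi1 fr1 [//|im1] _] := fs1; have [fi2 fr2 [//|im2] _] := fs2.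
have rr4 : rreg s2 4%N = 0 by rewrite fr2 // fr1.
have found0 : ireg s2 rFound = 0%N by rewrite fi2 // fi1.
have im0 j : imem s2 j = 0%N by rewrite im2 im1.
have ps2 : params m n s2 by case: ps; split; rewrite fi2.
move: {fs1 fs2 fi1 fr1 im1 fi2 fr2 im2 ps inv0} r2 h1 e1 h2 e2 hZ low high rr4 found0 im0 ps2.
case: s2 => l ir rr im rm [/= r0 r1] h1 e1 h2 e2 hZ low high rr4 found0 im0.
move=> [/= pM pN pK pD pZ].
apply: wp_seq (leqnn _) _; apply: wp_blk => //=; apply: wp_seq (leqnn _) _.
rewrite -z1 -z2 !r0 !addn0.
pose g (v : seq {set 'I_n}) i := sum (nth set0 v i).
apply: (@wp_match _ m n (size v1) (size v2) (g v1) (g v2)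
  (fun r => rm0 (m * n + r)%N) _ _ _ (ir rS1) (ir rS2)) => //=.
- by move=> i i'; apply: sorted_subsets_mono so1.
- by move=> i i'; apply: sorted_subsets_mono so2.
- by rewrite z2 expn_gt0.
- move=> r rm1; rewrite /add_at pD pZ !low ?[X in _ + X]rm0Z ?addr0 ?leq_addr //.
    by rewrite -/Z /K; lia.
  by rewrite -/Z /Z /K; lia.
case=> l3 ir3 rr3 im3 rm3 /= [/= fi3 fr3 [//|/= im3E] [//|/= rm3E]] [/= best fd].
subst im3 rm3.
have sub1 i : (i < size v1)%N -> nth set0 v1 i \subset parity_set n (odd n) n.
  by move=> iv; have := mem_nth set0 iv; rewrite so1.2 powersetE.
have sub2 i : (i < size v2)%N -> nth set0 v2 i \subset parity_set n (~~ odd n) n.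
  by move=> iv; have := mem_nth set0 iv; rewrite so2.2 powersetE.
have sumU i j r : (i < size v1)%N -> (j < size v2)%N ->
    sum (nth set0 v1 i :|: nth set0 v2 j) r = g v1 i r + g v2 j r.
  move=> iv jv; apply: subset_sumU.
  exact: disjointWl (sub1 _ iv) (disjointWr (sub2 _ jv) (parity_sets_disjoint _ _)).
(* A solution splits by parity into an entry of each list, so the search over pairs misses none. *)
have split_sol S : solution S -> exists i j, [/\ (i < size v1)%N, (j < size v2)%N,
    hit m (g v1) (g v2) (fun r => rm0 (m * n + r)%N) i j &
    cost m (g v1) (g v2) i j = sum S m].
  move=> sol.
  have S1v : S :&: parity_set n (odd n) n \in v1 by rewrite so1.2 powersetE subsetIr.
  have S2v : S :&: parity_set n (~~ odd n) n \in v2 by rewrite so2.2 powersetE subsetIr.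
  exists (index (S :&: parity_set n (odd n) n) v1),
    (index (S :&: parity_set n (~~ odd n) n) v2).
  have e r : g v1 (index (S :&: parity_set n (odd n) n) v1) r +
             g v2 (index (S :&: parity_set n (~~ odd n) n) v2) r = sum S r.
    by rewrite -sumU ?index_mem // !nth_index // -setIUr parity_setsU setIT.
  by rewrite !index_mem; split=> //; [move=> r rm1; rewrite e sol|exact: e].
have g0 : ir3 rZero = 0%N by rewrite fi3.
have gOne : ir3 rOne = 1%N by rewrite fi3.
have gN : ir3 rN = n by rewrite fi3.
have gM : ir3 rM = m by rewrite fi3.
apply: wp_output => //=; first by rewrite fr3.
move=> s4 [_ fr4 _ _] eF hbits; apply: hQ; rewrite /solved.
rewrite eF fr4 //=; case: fd => [f0|[f1 [i [j [iv jv ht eR [eBP eBQ]]]]]].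
  right; split=> // S /split_sol [i [j [iv jv ht _]]].
  by have [] := best i j iv jv isT ht; rewrite f0.
left; split=> //; exists (nth set0 v1 i :|: nth set0 v2 j); split.
- by move=> r rm1; rewrite sumU // ht.
- by rewrite eR sumU.
- move=> k; rewrite hbits // eBP eBQ gM /add_at.
  have blk a b : (a + b * K + m + 1 + k = a + b * K + (m + 1 + k))%N by lia.
  have kK : (m + 1 + k < K)%N by rewrite /K; have := ltn_ord k; lia.
  rewrite -/K !blk h1 // h2 // -[_ + _]sumU // subset_sum_bit.
  by rewrite ltr0n lt0b.
- move=> S /split_sol [i' [j' [iv' jv' ht' <-]]]; rewrite sumU //.
  by have [_] := best i' j' iv' jv' isT ht'; rewrite eR.
Qed.

End Solve.

(** * From runs of the program to the integer program *)

Definition solve_program : program := compile 0 solve_cmd.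

Section Correctness.
Variables (R : realType) (m n : nat).

Lemma run_solve (data : seq R) : (size data <= m * n + m + n)%N ->
  exists t s, [/\ run solve_program (init m n data) t s,
    (t <= solve_time m n)%N & solved m n (nth 0 data) s].
Proof.
move=> sz.
have data0 x : (m * n + m + n <= x)%N -> nth 0 data x = 0.
  by move=> le; rewrite nth_default // (leq_trans sz).
have [t [s [e le sol]]] := wp_solve data0 (fun s h => h).
exists t, (setpc (size solve_program) s); split=> //.
exact: run_compile e isT.
Qed.

(** With each term bounded by a multiple of [m * 2 ^ uphalf n], the coefficients add up to 145 in
    degree 0 in [n], 126 in degree 1 and 27 in degree 2; [145 * n.+1 ^ 2] dominates all three. *)
Lemma solve_time_le : (0 < m)%N ->
  (solve_time m n <= m * 2 ^ uphalf n * (145 * n.+1 ^ 2))%N.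
Proof.
move=> m0; rewrite /solve_time.
have : (2 ^ n./2 <= 2 ^ uphalf n)%N by rewrite leq_exp2l // uphalf_half leq_addl.
have : (0 < 2 ^ uphalf n)%N by rewrite expn_gt0.
move: (2 ^ n./2)%N (2 ^ uphalf n)%N => H E E0 HE.
have mE : (m <= m * E)%N by rewrite leq_pmulr.
have EmE : (E <= m * E)%N by rewrite leq_pmull.
have HmE : (H <= m * E)%N by exact: leq_trans HE EmE.
have mH : (H * m <= m * E)%N by rewrite mulnC leq_mul2l HE orbT.
have nmE : (n <= n * (m * E))%N by rewrite leq_pmulr // muln_gt0 m0.
have nm : (n * m <= n * (m * E))%N by rewrite leq_mul2l mE orbT.
have nE : (n * E <= n * (m * E))%N by rewrite leq_mul2l EmE orbT.
have nnE : (n * n * E <= n * n * (m * E))%N by rewrite leq_mul2l EmE orbT.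
nia.
Qed.

(** Rounding up adds at most 1/2, hence at most 1, to the exponent. *)
Lemma powR_half_ge : (2 ^ uphalf n)%:R <= 2 * 2 `^ (n%:R / 2) :> R.
Proof.
rewrite natrX -powR_mulrn ?ler0n // -[X in X * _ `^ _]powRr1 ?ler0n // -powRD; last first.
  by apply/implyP; rewrite pnatr_eq0.
apply: ler_powR; first by rewrite ler1n.
rewrite -(ler_pM2r (ltr0n R 2)) mulrDl divfK ?pnatr_eq0 //.
by rewrite mul1r -natrM -natrD ler_nat uphalf_half; lia.
Qed.

Variables (A : 'M[R]_(m, n)) (b : 'cV[R]_m).

Definition incidence (S : {set 'I_n}) : 'cV[R]_n := \col_j (j \in S)%:R.

Lemma incidence_support (x : 'cV[R]_n) :
  (forall j, x j 0 = 0 \/ x j 0 = 1) -> incidence [set j | x j 0 == 1] = x.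
Proof.
move=> h; apply/matrixP=> j k; rewrite ord1 !mxE inE.
by case: (h j) => ->; rewrite ?eqxx // eq_sym oner_eq0.
Qed.

Lemma feasible_incidence (tl : seq R) (S : {set 'I_n}) :
  feasible A b (incidence S) <-> solution m (nth 0 (feas_data A b ++ tl)) S.
Proof.
set rm0 := nth 0 _.
have sumE (i : 'I_m) : subset_sum m rm0 S i = (A *m incidence S) i 0.
  rewrite mxE /subset_sum big_mkcond; apply: eq_bigr => j _.
  rewrite mxE /column ltn_ord /rm0 nth_data_A.
  by case: (_ \in _); rewrite ?mulr1 ?mulr0.
split=> [[_ e] r rm|sol].
  by rewrite (sumE (Ordinal rm)) e /rm0 (nth_data_b A b tl (Ordinal rm)).
split; first by move=> j; rewrite mxE; case: (_ \in _); [right|left].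
by apply/matrixP=> i k; rewrite ord1 -sumE sol // /rm0 nth_data_b.
Qed.

Lemma objective_incidence (c : 'cV[R]_n) (S : {set 'I_n}) :
  objective c (incidence S) =
  subset_sum m (nth 0 (feas_data A b ++ [seq c j 0 | j <- enum 'I_n])) S m.
Proof.
rewrite /objective mxE /subset_sum [RHS]big_mkcond; apply: eq_bigr => j _.
rewrite !mxE /column ltnn eqxx nth_cat size_feas_data.
rewrite (_ : (j + m * n + m = m * n + m + j)%N); last by lia.
rewrite ltnNge leq_addr /= addKn (nth_map j) ?size_enum_ord // nth_ord_enum.
by case: (_ \in _); rewrite ?mulr1 ?mulr0.
Qed.

End Correctness.

Lemma output_incidence (R : realType) n (s : config R) (S : {set 'I_n}) :
  (forall j : 'I_n, imem s j = (j \in S)) -> output n s = incidence R S.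
Proof. by move=> h; apply/matrixP=> j k; rewrite !mxE h. Qed.

Lemma solve_in_time (R : realType) : exists p : {poly nat},
  forall m n (data : seq R) t s, (0 < m)%N -> (size data <= m * n + m + n)%N ->
  run solve_program (init m n data) t s -> t%:R <= time_bound R p m n.
Proof.
(* 290 is the constant 145 of [solve_time_le] times the factor 2 lost in rounding [n/2] up. *)
exists (290%:P * ('X + 1%:P) ^+ 2) => m n data t s m0 sz r.
have [t' [s' [r' le _]]] := run_solve sz.
rewrite (run_functional r r') /time_bound.
have -> : (290%:P * ('X + 1%:P) ^+ 2).[n] = (290 * n.+1 ^ 2)%N.
  by rewrite !(hornerM, horner_exp, hornerD, hornerX, hornerC) -[n.+1]addn1.
apply: le_trans (_ : (m * 2 ^ uphalf n * (145 * n.+1 ^ 2))%:R <= _).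
  by rewrite ler_nat (leq_trans le) // solve_time_le.
have := powR_half_ge R n; rewrite -subr_ge0 => PE.
move: (2 ^ uphalf n)%N (2 `^ _) (n.+1 ^ 2)%N PE => E P y PE.
rewrite !natrM -subr_ge0.
rewrite (_ : _ - _ = m%:R * y%:R * 145 * (2 * P - E%:R)); last by ring.
by rewrite !mulr_ge0 ?ler0n.
Qed.

Theorem theorem1 (R : realType) :
  (exists P : program, solves_feasibility R P /\ feasibility_in_time R P) /\
  (exists P : program, solves_optimization R P /\ optimization_in_time R P).
Proof.
have sz1 m n (A : 'M[R]_(m, n)) b : (size (feas_data A b) <= m * n + m + n)%N.
  by rewrite size_feas_data leq_addr.
have sz2 m n (A : 'M[R]_(m, n)) b (c : 'cV[R]_n) :
    (size (feas_data A b ++ [seq c j 0%R | j <- enum 'I_n]) <= m * n + m + n)%N.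
  by rewrite size_cat size_feas_data size_map_enum.
have [p hp] := solve_in_time R.
split; exists solve_program; split.
- move=> m n A b; have [t [s [r _ sol]]] := run_solve (sz1 _ _ A b).
  (* Feasibility is the case of an empty tail; the minimality that the program also delivers is then
     dropped. *)
  exists t, s; split=> //; rewrite -[feas_data A b]cats0 in sol.
  case: sol => [[e [S [sol _ bits _]]]|[e no]]; [left|right]; split=> //.
    by rewrite (output_incidence bits); apply/feasible_incidence; exact: sol.
  move=> x [bin e']; apply: (no [set j | x j 0 == 1]).
  by apply/feasible_incidence; rewrite incidence_support.
- by move=> q; exists p => m n A b t s m0 _; apply: hp.
- move=> m n A b c; have [t [s [r _ sol]]] := run_solve (sz2 _ _ A b c).
  exists t, s; split=> //.
  case: sol => [[e [S [sol val bits opt]]]|[e no]]; [left|right]; split=> //.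
    rewrite (output_incidence bits); split.
    + by apply/feasible_incidence; exact: sol.
    + by rewrite val (objective_incidence A b).
    move=> y fy; rewrite -(incidence_support fy.1) !(objective_incidence A b).
    by apply: opt; apply/feasible_incidence; rewrite (incidence_support fy.1).
  move=> x [bin e']; apply: (no [set j | x j 0 == 1]).
  by apply/feasible_incidence; rewrite incidence_support.
- by move=> q; exists p => m n A b c t s m0 _; apply: hp.
Qed.
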